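(* Let $a<b$ be real numbers and let $\alpha,\beta>0$ satisfy $\alpha\beta<1$, $\alpha\beta\notin\mathbb{Q}$ and $\alpha<b-a$. Let $g:\mathbb{R}\to\mathbb{C}$ be such that $g\in L^\infty(\mathbb{R})$, $g(x)=0$ for $x\notin(a,b)$, and $g^{-1}\in L^\infty([a+\varepsilon,b-\varepsilon])$, where $\varepsilon=\frac12\min\left(b-a-\alpha,\ \alpha,\ \frac1\beta-\alpha\right)$. Assume that there exist a nonempty open interval $I\subset(0,\alpha)$ and $\delta>0$ such that $|\det(M_x)|\ge\delta$ for all $x\in I$, where $M_x$ is the finite square submatrix of the Ron--Shen matrix described in the context. Then the Gabor system $\mathcal{G}(g;\alpha,\beta)$ is a frame.
   Context: For $g\in L^2(\mathbb{R})$ and $\alpha,\beta>0$, the Gabor system is $\mathcal{G}(g;\alpha,\beta)=\{g_{m,n}\}_{m,n\in\mathbb{Z}}$, where $g_{m,n}(x)=e^{2\pi i\beta m x}g(x-\alpha n)$. It is a frame if there are constants $A_0,B_0>0$ such that $A_0\|h\|_2^2\le\sum_{m,n\in\mathbb{Z}}|(h,g_{m,n})|^2\le B_0\|h\|_2^2$ for all $h\in L^2(\mathbb{R})$. The matrices $M_x$. The Ron--Shen matrix is the infinite matrix $G(x)=\{g(x-\alpha n+\frac1\beta m)\}_{n,m\in\mathbb{Z}}$, with rows indexed by $n$ and columns by $m$. For given $x$, a pair $(n,m)\in\mathbb{Z}^2$ is called good if $x-\alpha n+\frac1\beta m\in(a,b)$; entries of $G(x)$ at pairs that are not good are zero. For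 each $x\in[0,\alpha]$ fix a good pair $(n_x,m_x)$ which is the first in its row, i.e. $(n_x,m_x)$ is good and $(n_x,m)$ is not good for $m<m_x$; the choice is made so that $|n_x|,|m_x|$ are bounded by a constant depending only on $\alpha,\beta,a,b$ (such a choice is possible when $\alpha\beta<1$ and $\alpha<b-a$). Let $l_x\ge0$ be the biggest integer $l$ such that $x-\alpha(n_x+l)+\frac1\beta(m_x+l)<b$ (it exists since $\frac1\beta-\alpha>0$). Then $M_x$ is the $(l_x+1)\times(l_x+1)$ matrix formed by the rows $n_x,\dots,n_x+l_x$ and the columns $m_x,\dots,m_x+l_x$ of $G(x)$, i.e. $$M_x=\left\{g\left(x-\alpha(n_x+i)+\tfrac1\beta(m_x+j)\right)\right\}_{0\le i,j\le l_x}.$$ *)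

(* Defs.v *)
From mathcomp Require Import all_boot all_order all_algebra.
From mathcomp Require Import all_classical all_reals all_analysis.
From mathcomp Require Import complex.

Set Implicit Arguments.
Unset Strict Implicit.
Unset Printing Implicit Defensive.

Import Order.TTheory GRing.Theory Num.Theory.
Import numFieldNormedType.Exports.
Import Normc.

Local Open Scope classical_set_scope.
Local Open Scope ring_scope.

(* The carrier is R itself; its sigma-algebra is that of the Lebesgue measurable
   (and not merely Borel) sets. *)
Notation lebR R := (caratheodory_type (wlength (@idfun R))^*%mu).
Notation leb := completed_lebesgue_measure.

Section ComplexFunctionSpaces.
Context {R : realType}.
Implicit Types (f h k : R -> R[i]) (p : \bar R) (D : set R).

Definition cmeasurable f :=
  measurable_fun [set: lebR R] (fun x : lebR R => complex.Re (f x)) /\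
  measurable_fun [set: lebR R] (fun x : lebR R => complex.Im (f x)).

Definition in_Lp p f := cmeasurable f /\ finite_norm (@leb R) p (fun x => normc (f x)).

Definition in_L2 f := in_Lp 2%:E f.

Definition in_Linfty f := in_Lp +oo%E f.

(* L^oo(D), as the functions whose extension by 0 outside D is in L^oo(R) *)
Definition in_Linfty_on D f := in_Linfty (fun x => if x \in D then f x else 0).

(* As 0^-1 = 0 in MathComp, g has to be required to be nonzero a.e. on D. *)
Definition inv_in_Linfty_on D f :=
  {ae (@leb R), forall x, D x -> f x != 0} /\
  in_Linfty_on D (fun x => (f x)^-1).

Definition cintegral f : R[i] :=
  Complex (\int[@leb R]_x complex.Re (f x)) (\int[@leb R]_x complex.Im (f x)).

Definition inner h k : R[i] := cintegral (fun x => h x * (k x)^*%C).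

Definition L2norm h : \bar R := Lnorm (@leb R) 2%:E (fun x => (normc (h x))%:E).

End ComplexFunctionSpaces.

Section Gabor.
Context {R : realType}.
Implicit Types (g : R -> R[i]) (a b alpha beta x : R) (n m : int) (l : nat).

Definition expi (t : R) : R[i] := Complex (cos t) (sin t).

Definition gabor_atom g alpha beta m n : R -> R[i] :=
  fun x => expi (2 * pi * beta * m%:~R * x) * g (x - alpha * n%:~R).

Definition gabor_frame g alpha beta :=
  exists A0 B0 : R, [/\ 0 < A0, 0 < B0 &
    forall h, in_L2 h ->
      let S := (\esum_(mn in [set: int * int])
        ((normc (inner h (gabor_atom g alpha beta mn.1 mn.2))) ^+ 2)%:E)%E in
      (A0%:E * L2norm h ^+ 2 <= S)%E /\ (S <= B0%:E * L2norm h ^+ 2)%E].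

Definition ron_shen_point alpha beta x n m : R :=
  x - alpha * n%:~R + beta^-1 * m%:~R.

Definition ron_shen g alpha beta x n m : R[i] :=
  g (ron_shen_point alpha beta x n m).

Definition good a b alpha beta x n m :=
  ron_shen_point alpha beta x n m \in `]a, b[.

Definition first_good a b alpha beta x n m :=
  good a b alpha beta x n m /\
  forall m', m' < m -> ~~ good a b alpha beta x n m'.

(* An arbitrary choice x |-> (n_x, m_x), not assumed measurable, with a uniform
   bound over [0, alpha]. *)
Definition start_choice a b alpha beta (nx mx : R -> int) :=
  (forall x, x \in `[0, alpha] -> first_good a b alpha beta x (nx x) (mx x)) /\
  exists K : int, forall x, x \in `[0, alpha] -> `|nx x| <= K /\ `|mx x| <= K.

Definition biggest_l b alpha beta x n m l :=
  let P k := ron_shen_point alpha beta x (n + k%:Z) (m + k%:Z) < b in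
  P l /\ forall k : nat, P k -> (k <= l)%N.

Definition Mmx g alpha beta x n m l : 'M[R[i]]_(l.+1) :=
  \matrix_(i, j) ron_shen g alpha beta x (n + (i : nat)%:Z) (m + (j : nat)%:Z).

End Gabor.

(* Main.v *)
Require Import Defs.
From mathcomp Require Import all_boot all_order all_algebra.
From mathcomp Require Import all_classical all_reals all_analysis.
From mathcomp Require Import complex.
From mathcomp Require Import perm measurable_realfun ess_sup_inf.
From mathcomp Require Import zify ring lra.

Set Implicit Arguments.
Unset Strict Implicit.
Unset Printing Implicit Defensive.

Import Order.TTheory GRing.Theory Num.Theory.
Import numFieldNormedType.Exports.
Import Normc.

Local Open Scope classical_set_scope.
Local Open Scope ring_scope.

(** The frame bounds are uniform bounds on an operator that, by periodizing the
    variable [x] with period [beta^-1], splits into the matrices [G(x)]; the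
    theorem thus asks for a bound on [G(x)] from above and from below, uniform
    in almost every [x], and for a dictionary between the two.

    Dictionary.  The coefficient of [h] against the atom [(m, n)] is the [m]-th
    Fourier coefficient of the compactly supported function
    [h * conj (g (. - alpha n))], or equally of its [beta^-1]-periodization,
    whose value at [x] is the [n]-th row of [conj G(x)] applied to the samples
    [h (x + beta^-1 k)].  Parseval's identity on one period turns the sum over
    [m] into the square norm of this row.  It is obtained here as two real
    inequalities for the orthogonal system [cos + sin] ([hartley_bessel] and
    [hartley_parseval], the latter by Fejer's theorem); they combine into
    [esum_fcoef_le] and [esum_fcoef_ge].

    Upper bound ([gabor_sum_le]).  The window is bounded with bounded support,
    so every row has boundedly many nonzero entries, and every [x] belongs to
    boundedly many translates of the support.

    Lower bound ([gabor_sum_ge]).  It suffices that [h x] be controlled by the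
    rows [n] with [alpha n] at bounded distance from [x] ([rows_control]).  The
    rows of the block [M_y] vanish outside its columns, so where its determinant
    is bounded below, Cramer's rule recovers the samples in these columns.  As
    [alpha beta] is irrational, the points [x + beta^-1 s] modulo [alpha] visit
    the good interval with bounded gaps ([rotation_recurrence]), so such a block
    begins at bounded distance to the left of any given column.  From there one
    moves right column by column ([propagate]): the row whose point in the next
    column falls just below [b - eps] has its last nonzero entry there, of
    modulus bounded below, and its other entries in columns already recovered.
    Such a row exists because both [b - a] and [beta^-1] exceed [alpha] by at
    least [2 eps], which leaves room for a target interval of length [alpha]. *)

(** * Symmetric ranges of integers *)

Definition symrange (M : nat) : seq int :=
  [seq i%:Z - M%:Z | i <- iota 0 M.*2.+1].

Lemma symrange_uniq M : uniq (symrange M).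
Proof. by rewrite map_inj_uniq ?iota_uniq// => i j; lia. Qed.

Lemma mem_symrange M k : (k \in symrange M) = (`|k| <= M%:Z).
Proof.
apply/mapP/idP => [[n] | kM]; first by rewrite mem_iota => iM ->; lia.
by exists (absz (k + M%:Z)); rewrite ?mem_iota; lia.
Qed.

Lemma size_symrange M : size (symrange M) = M.*2.+1.
Proof. by rewrite size_map size_iota. Qed.

Lemma perm_symrangeN M : perm_eq [seq - k | k <- symrange M] (symrange M).
Proof.
apply: uniq_perm; rewrite ?(map_inj_uniq oppr_inj) ?symrange_uniq//.
move=> k; rewrite mem_symrange; apply/mapP/idP => [[j] | kM].
  by rewrite mem_symrange => jM ->; rewrite normrN.
by exists (- k); rewrite ?mem_symrange ?normrN ?opprK.
Qed.

Lemma sum_symrange_odd (V : realDomainType) M (f : int -> V) :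
  (forall k, f (- k) = - f k) -> \sum_(k <- symrange M) f k = 0.
Proof.
move=> fN; set S := LHS; have : S = - S.
  rewrite {1}/S -(perm_big _ (perm_symrangeN M)) big_map /= -sumrN.
  by apply: eq_bigr => k _; rewrite fN.
lra.
Qed.

Lemma big_support (V : nmodType) (T : eqType) (s s' : seq T) (f : T -> V) :
  uniq s -> uniq s' -> {subset s' <= s} ->
  (forall k, k \in s -> k \notin s' -> f k = 0) ->
  \sum_(k <- s) f k = \sum_(k <- s') f k.
Proof.
move=> us us' ss' f0.
rewrite (bigID [in s'])/= [X in _ + X]big_seq_cond [X in _ + X]big1 ?addr0.
  rewrite -big_filter; apply: perm_big; apply: uniq_perm => //.
    exact: filter_uniq.
  move=> k; rewrite mem_filter; case: (boolP (k \in s')) => //= /ss' ->//.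
by move=> k /andP[]; exact: f0.
Qed.

Lemma sum_symrange_window (V : nmodType) Q (m0 : int) l (f : int -> V) :
  `|m0| <= Q%:Z -> `|m0 + l%:Z| <= Q%:Z ->
  (forall k, k < m0 -> f k = 0) -> (forall k, m0 + l%:Z < k -> f k = 0) ->
  \sum_(k <- symrange Q) f k = \sum_(j < l.+1) f (m0 + (j : nat)%:Z).
Proof.
move=> m0Q mlQ flt fgt.
rewrite (@big_support _ _ _ [seq m0 + j%:Z | j <- iota 0 l.+1]).
- by rewrite big_map -[X in iota 0 X]subn0 -/(index_iota 0 l.+1) big_mkord.
- exact: symrange_uniq.
- by rewrite map_inj_uniq ?iota_uniq// => i j; lia.
- by move=> k /mapP[j]; rewrite mem_iota mem_symrange => jl ->; lia.
- move=> k _ /mapP kn; have [km|mk] := ltP k m0; first exact: flt.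
  have [mlk|kml] := ltP (m0 + l%:Z) k; first exact: fgt.
  by case: kn; exists (absz (k - m0)); rewrite ?mem_iota; lia.
Qed.

(** * Recurrence of an irrational rotation *)

Section recurrence.
Context {R : realType}.

(** Pigeonhole on the fractional parts of the first multiples of the step; two
    of them cannot coincide exactly because the ratio is irrational. *)
Lemma small_return (alpha gamma e : R) : 0 < alpha -> irrational (alpha / gamma) ->
  0 < gamma -> 0 < e ->
  exists (q : nat) (r : int), 0 < `|q%:R * gamma - r%:~R * alpha| < e.
Proof.
move=> alpha0 irr gamma0 e0.
pose N := (Num.truncn (alpha / e)).+1.
have N0 : 0 < N%:R :> R by rewrite ltr0n.
have Ne : alpha < N%:R * e by rewrite -ltr_pdivrMr// truncnS_gt.
pose fr (i : nat) : R := i%:R * (gamma / alpha) -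
  (Num.floor (i%:R * (gamma / alpha)) : int)%:~R.
have fr01 i : 0 <= fr i < 1.
  have := floorD1_gt (i%:R * (gamma / alpha)).
  by rewrite /fr subr_ge0 floor_le/= intrD; lra.
have bkt i : (Num.truncn (N%:R * fr i) < N)%N.
  have /andP[f0 f1] := fr01 i.
  have Nf0 : 0 <= N%:R * fr i by rewrite mulr_ge0// ltW.
  have kN : (Num.truncn (N%:R * fr i))%:R <= N%:R * fr i by rewrite truncn_le.
  by rewrite -(ltr_nat R) (le_lt_trans kN)// gtr_pMr.
pose h (i : 'I_N.+1) : 'I_N := Ordinal (bkt i).
have /injectivePn[i [j ij hij]] : ~~ injectiveb h.
  apply/negP => /injectiveP /leq_card.
  by rewrite !card_ord ltnn.
wlog {ij} lt_ij : i j hij / (i < j)%N.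
  move=> W; have [lt|gt|/val_inj e1] := ltngtP i j.
  - exact: (W i j).
  - by apply: (W j i).
  - by rewrite e1 eqxx in ij.
have frd : `|fr j - fr i| < N%:R^-1.
  move/(congr1 val): hij => /= hij.
  have /andP[fi0 _] := fr01 i; have /andP[fj0 _] := fr01 j.
  have /truncn_itv/andP[] : 0 <= N%:R * fr i by rewrite mulr_ge0// ltW.
  have /truncn_itv/andP[] : 0 <= N%:R * fr j by rewrite mulr_ge0// ltW.
  rewrite -hij; set k := Num.truncn _ => h1 h2 h3 h4.
  rewrite -[X in _ < X]mul1r ltr_pdivlMr// -[X in _ * X]gtr0_norm//.
  rewrite -normrM ltr_norml; move: h2 h4; rewrite -natr1; nra.
exists (j - i)%N, (Num.floor (j%:R * (gamma / alpha)) -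
               Num.floor (i%:R * (gamma / alpha))).
have -> : (j - i)%:R * gamma - (Num.floor (j%:R * (gamma / alpha)) -
      Num.floor (i%:R * (gamma / alpha)))%:~R * alpha = (fr j - fr i) * alpha.
  rewrite natrB ?(ltnW lt_ij)// /fr intrB; field; lra.
rewrite normrM (gtr0_norm alpha0); apply/andP; split; last first.
  rewrite (lt_trans (y := N%:R^-1 * alpha)) ?ltr_pM2r//.
  by rewrite mulrC ltr_pdivrMr// mulrC.
rewrite mulr_gt0// normr_gt0; apply/eqP => frE; apply: irr.
pose q := (j - i)%:R : rat.
pose r := (Num.floor (j%:R * (gamma / alpha)) -
               Num.floor (i%:R * (gamma / alpha)))%:~R : rat.
exists (q / r) => //=.
have qE : ratr q * (gamma / alpha) = ratr r :> R.
  rewrite /q /r ratr_nat ratr_int natrB ?(ltnW lt_ij)// intrB.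
  by move: frE; rewrite /fr; lra.
have q0 : ratr q != 0 :> R.
  by rewrite ratr_nat pnatr_eq0 subn_eq0 -ltnNge.
rewrite fmorph_div/= -qE; move: (ratr q) q0 => Q q0.
by field; rewrite q0 !gt_eqF.
Qed.

(** Walking by multiples of a return shorter than [d - c] cannot jump over the
    interval; the number of steps needed to cross a period is independent of the
    starting point, which makes the bound [S] uniform. *)
Lemma rotation_recurrence (alpha gamma c d : R) : 0 < alpha -> 0 < gamma ->
  irrational (alpha / gamma) -> c < d ->
  exists S : nat, forall x : R, exists (s : nat) (r : int),
    (s <= S)%N /\ c < x + gamma * s%:R - alpha * r%:~R < d.
Proof.
move=> alpha0 gamma0 irr cd.
have dc0 : 0 < d - c by rewrite subr_gt0.
have [q [r /andP[th0 thd]]] := small_return alpha0 irr gamma0 dc0.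
move: th0 thd; set th := _ - _ => th0 thd.
(* Steps of size [th] that suffice to travel a distance [alpha]. *)
pose T := (Num.truncn (alpha / `|th|)).+1.
have T_gt z : 0 <= z < alpha -> ((Num.truncn (z / `|th|)).+1 <= T)%N.
  move=> /andP[z0 za]; rewrite ltnS le_truncn//.
  by rewrite ler_pM2r ?invr_gt0// ltW.
exists (T * q)%N => x.
move: th0; rewrite normr_gt0 neq_lt => /orP[th0|th0].
- pose r0 := Num.floor ((x - d) / alpha).
  pose y := x - alpha * r0%:~R.
  have y1 : 0 <= y - d < alpha.
    have := floor_le ((x - d) / alpha); have := floorD1_gt ((x - d) / alpha).
    rewrite ler_pdivlMr// ltr_pdivrMr// intrD mulrDl -/r0 /y; lra.
  pose k := Num.truncn ((y - d) / `|th|); pose t := k.+1.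
  have tT : (t <= T)%N := T_gt _ y1.
  have /truncn_itv/andP[] : 0 <= (y - d) / `|th|.
    by apply: divr_ge0 => //; lra.
  rewrite -/k (ler_pdivlMr) ?(ltr_pdivrMr) ?normr_gt0 ?lt_eqF// => t1 t2.
  exists (t * q)%N, (r0 + t%:Z * r); split; first by rewrite leq_mul2r tT orbT.
  have -> : x + gamma * (t * q)%:R - alpha * (r0 + t%:Z * r)%:~R = y + t%:R * th.
    by rewrite natrM intrD intrM /y /th; ring.
  move: t1 t2; rewrite (ltr0_norm th0) in thd *.
  rewrite /t -natr1; nra.
- pose r0 := Num.ceil ((x - c) / alpha).
  pose y := x - alpha * r0%:~R.
  have y1 : 0 <= c - y < alpha.
    have := ceil_ge ((x - c) / alpha); have := ceilB1_lt ((x - c) / alpha).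
    rewrite ler_pdivrMr// ltr_pdivlMr// intrB mulrBl -/r0 /y; lra.
  pose k := Num.truncn ((c - y) / `|th|); pose t := k.+1.
  have tT : (t <= T)%N := T_gt _ y1.
  have /truncn_itv/andP[] : 0 <= (c - y) / `|th|.
    by apply: divr_ge0 => //; lra.
  rewrite -/k (ler_pdivlMr) ?(ltr_pdivrMr) ?normr_gt0 ?gt_eqF// => t1 t2.
  exists (t * q)%N, (r0 + t%:Z * r); split; first by rewrite leq_mul2r tT orbT.
  have -> : x + gamma * (t * q)%:R - alpha * (r0 + t%:Z * r)%:~R = y + t%:R * th.
    by rewrite natrM intrD intrM /y /th; ring.
  move: t1 t2; rewrite (gtr0_norm th0) in thd *.
  rewrite /t -natr1; nra.
Qed.

End recurrence.


(** * The complex modulus and Cramer's rule *)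

Section normc_facts.
Context {R : rcfType}.
Implicit Types z : R[i].

Lemma normc_ge0 z : 0 <= normc z.
Proof. by case: z => x y; exact: sqrtr_ge0. Qed.

Lemma normc_conj z : normc z^*%C = normc z.
Proof. by case: z => x y /=; rewrite sqrrN. Qed.

Lemma sqr_normcE z : normc z ^+ 2 = complex.Re z ^+ 2 + complex.Im z ^+ 2.
Proof. by case: z => x y /=; rewrite sqr_sqrtr// addr_ge0 ?sqr_ge0. Qed.

Lemma normc_sum (I : Type) (s : seq I) (P : pred I) (F : I -> R[i]) :
  normc (\sum_(k <- s | P k) F k) <= \sum_(k <- s | P k) normc (F k).
Proof.
elim/big_ind2 : _ => //; first by rewrite normc0.
by move=> x1 x2 y1 y2 h1 h2; rewrite (le_trans (le_normcD _ _))// lerD.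
Qed.

Lemma normc_prod (I : Type) (s : seq I) (P : pred I) (F : I -> R[i]) :
  normc (\prod_(k <- s | P k) F k) = \prod_(k <- s | P k) normc (F k).
Proof. by elim/big_ind2 : _ => [|x1 x2 y1 y2 <- <-|//]; rewrite ?normc1 ?normcM. Qed.

Lemma normc_sign n : normc ((-1) ^+ n) = 1 :> R.
Proof. by elim: n => [|n IH]; rewrite ?expr0 ?normc1// exprS normcM normcN normc1
  mul1r. Qed.

Lemma normc_det_le n (A : 'M[R[i]]_n) (B : R) :
  (forall i j, normc (A i j) <= B) -> normc (\det A) <= n`!%:R * B ^+ n.
Proof.
move=> AB; rewrite (le_trans (normc_sum _ _ _))//.
rewrite (le_trans (y := \sum_(s : 'S_n) B ^+ n))//.
  apply: ler_sum => s _; rewrite normcM normc_sign mul1r normc_prod.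
  rewrite -[X in _ <= _ ^+ X]card_ord -prodr_const; apply: ler_prod => i _.
  by rewrite normc_ge0 AB.
by rewrite sumr_const card_Sn mulr_natl.
Qed.

(** Cramer's rule: the adjugate inverts the matrix up to its determinant, and
    its entries are minors. *)
Lemma normc_solve_le n (A : 'M[R[i]]_n.+1) (w : 'cV[R[i]]_n.+1) (B delta t : R) :
  (forall i j, normc (A i j) <= B) -> 0 < delta -> delta <= normc (\det A) ->
  (forall i, normc ((A *m w) i 0) <= t) ->
  forall j, normc (w j 0) <= delta^-1 * (n.+1%:R * (n`!%:R * B ^+ n)) * t.
Proof.
move=> AB d0 dA At j.
have B0 : 0 <= B := le_trans (normc_ge0 _) (AB j j).
have t0 : 0 <= t := le_trans (normc_ge0 _) (At j).
have : \det A * w j 0 = (\adj A *m (A *m w)) j 0.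
  by rewrite mulmxA mul_adj_mx mul_scalar_mx mxE.
move=> /(congr1 (@normc R)); rewrite normcM => E.
have : normc (\det A) * normc (w j 0) <= n.+1%:R * (n`!%:R * B ^+ n) * t.
  rewrite E mxE (le_trans (normc_sum _ _ _))//.
  rewrite (le_trans (y := \sum_(i < n.+1) n`!%:R * B ^+ n * t))//; last first.
    by rewrite sumr_const card_ord -[_ *+ _.+1]mulr_natl !mulrA.
  apply: ler_sum => i _; rewrite normcM ler_pM ?normc_ge0//.
  rewrite mxE normcM normc_sign mul1r; apply: normc_det_le => i' j'.
  by rewrite !mxE.
move=> h; rewrite -mulrA ler_pdivlMl//; apply: le_trans h.
by rewrite ler_wpM2r ?normc_ge0.
Qed.

End normc_facts.

(** * Lower bound for the rows of the Ron--Shen matrix *)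

Section rows.
Context {R : realType}.
Variables (a b alpha beta eps eta B : R) (g : R -> R[i]) (N : set R).
Hypothesis alpha0 : 0 < alpha.
Hypothesis beta0 : 0 < beta.
Hypothesis eps0 : 0 < eps.
Hypothesis eta0 : 0 < eta.
Hypothesis eps_ba : alpha + 2 * eps <= b - a.
Hypothesis eps_beta : alpha + 2 * eps <= beta^-1.
Hypothesis g_supp : forall x : R, x \notin `]a, b[ -> g x = 0.
Hypothesis g_bound : forall x, ~ N x -> normc (g x) <= B.
Hypothesis g_below : forall x, ~ N x -> x \in `[a + eps, b - eps] ->
  eta <= normc (g x).

Local Notation p := (ron_shen_point alpha beta).

Definition generic x := forall n m, ~ N (p x n m).

Definition row_sum Q x (v : int -> R[i]) n :=
  \sum_(k <- symrange Q) ron_shen g alpha beta x n k * v k.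

Lemma ron_shen_eq0l x n m : p x n m <= a -> ron_shen g alpha beta x n m = 0.
Proof. by move=> h; apply: g_supp; rewrite in_itv/= negb_and -leNgt h. Qed.

Lemma ron_shen_eq0r x n m : b <= p x n m -> ron_shen g alpha beta x n m = 0.
Proof. by move=> h; apply: g_supp; rewrite in_itv/= negb_and -!leNgt h orbT. Qed.

Lemma ron_shen_pointD x n m n' m' :
  p x (n + n') (m + m') = p x n m - alpha * n'%:~R + beta^-1 * m'%:~R.
Proof. by rewrite /ron_shen_point !intrD; ring. Qed.

Lemma ron_shen_point_shift x n m n' m' : p (p x n m) n' m' = p x (n' + n) (m' + m).
Proof. by rewrite /ron_shen_point !intrD; ring. Qed.

(** The four inequalities say that [(n0, m0)] is the first good pair of its row
    and that [l] is the largest number of diagonal steps, each moving the point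
    right by [beta^-1 - alpha], that stay in the support.  They are invariant
    under translating [x] by the lattice, unlike the choice of a starting pair. *)
Definition full_block x n0 m0 (l : nat) :=
  [/\ a < p x n0 m0, p x n0 m0 <= a + beta^-1,
      p x n0 m0 + (beta^-1 - alpha) * l%:R < b &
      b <= p x n0 m0 + (beta^-1 - alpha) * l.+1%:R].

(** The point of [(n0, m0)] is at most one column step above [a], and going
    down the rows only moves points to the left. *)
Lemma block_left x n0 m0 l (i : nat) (k : int) : full_block x n0 m0 l ->
  k < m0 -> ron_shen g alpha beta x (n0 + i%:Z) k = 0.
Proof.
move=> [p1 p2 p3 p4] km; apply: ron_shen_eq0l; rewrite -(subrK m0 k).
rewrite [X in p _ _ X]addrC ron_shen_pointD.
have k1 : (k - m0)%:~R <= -1 :> R by rewrite -[-1]/((-1)%:~R) ler_int; clear -km; lia.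
have : beta^-1 * (k - m0)%:~R <= - beta^-1.
  by rewrite -[X in _ <= X]mulrN1 ler_pM2l ?invr_gt0.
have : 0 <= alpha * (i%:Z)%:~R by rewrite mulr_ge0// ltW.
lra.
Qed.

(** The diagonal step after the last one reaches [b]; in the same column, the rows
    of the block lie above that entry and their points further to the right. *)
Lemma block_right x n0 m0 l (i : nat) (k : int) : full_block x n0 m0 l -> (i <= l)%N ->
  m0 + l%:Z < k -> ron_shen g alpha beta x (n0 + i%:Z) k = 0.
Proof.
move=> [p1 p2 p3 p4] il km; apply: ron_shen_eq0r; rewrite -(subrK m0 k).
rewrite [X in p _ _ X]addrC ron_shen_pointD.
have k1 : l.+1%:R <= (k - m0)%:~R :> R.
  by rewrite -[l.+1%:R]/((l.+1%:Z)%:~R) ler_int; clear -km; lia.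
have i1 : (i%:Z)%:~R <= l%:R :> R by rewrite -[l%:R]/((l%:Z)%:~R) ler_int; clear -il; lia.
have : beta^-1 * l.+1%:R <= beta^-1 * (k - m0)%:~R.
  by rewrite ler_pM2l ?invr_gt0.
have : alpha * (i%:Z)%:~R <= alpha * l%:R by rewrite ler_pM2l.
move: p4 alpha0; rewrite -natr1 !mulrDr !mulrBl; lra.
Qed.

Lemma block_row_sum x n0 m0 l Q v (i : 'I_l.+1) : full_block x n0 m0 l ->
  `|m0| <= Q%:Z -> `|m0 + l%:Z| <= Q%:Z ->
  row_sum Q x v (n0 + (i : nat)%:Z) =
  (Mmx g alpha beta x n0 m0 l *m (\col_j v (m0 + (j : nat)%:Z))) i 0.
Proof.
move=> blk m0Q mlQ; rewrite /row_sum (sum_symrange_window m0Q mlQ).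
- by rewrite mxE; apply: eq_bigr => j _; rewrite !mxE.
- by move=> k km; rewrite (block_left i blk km) mul0r.
- by move=> k km; rewrite (block_right blk _ km) ?mul0r// -ltnS.
Qed.

(** The row whose point in column [m] falls in [(b - eps - alpha, b - eps]], an
    interval of length [alpha]: there the window is bounded below, and one column
    step further right leaves the support. *)
Definition pivot_row x (m : int) : int :=
  Num.ceil ((x + beta^-1 * m%:~R - b + eps) / alpha).

Lemma pivot_rowP x m :
  b - eps - alpha < p x (pivot_row x m) m <= b - eps.
Proof.
rewrite /ron_shen_point /pivot_row.
set z := (X in Num.ceil X).
have := ceil_ge z; have := ceilB1_lt z; set c := Num.ceil z.
rewrite {2}/z ler_pdivrMr// {1}/z ltr_pdivlMr// intrB mulrBl; lra.
Qed.

Lemma pivot_row_right x (m k : int) : m < k ->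
  ron_shen g alpha beta x (pivot_row x m) k = 0.
Proof.
move=> mk; apply: ron_shen_eq0r.
have /andP[h1 h2] := pivot_rowP x m.
have -> : p x (pivot_row x m) k = p x (pivot_row x m) m + beta^-1 * (k - m)%:~R.
  by rewrite /ron_shen_point intrB; ring.
have k1 : 1 <= (k - m)%:~R :> R by rewrite -[1]/(1%:~R) ler_int; clear -mk; lia.
have : beta^-1 <= beta^-1 * (k - m)%:~R by rewrite ler_pMr ?invr_gt0.
move: eps_beta eps0; lra.
Qed.

(** [l + 2] column steps span the distance from [b] down to [a], because the
    block of size [l + 1] already exhausts the diagonal. *)
Lemma pivot_row_left x n0 m0 l (k : nat) (k' : int) : full_block x n0 m0 l -> (l < k)%N ->
  k' < m0 -> ron_shen g alpha beta x (pivot_row x (m0 + k%:Z)) k' = 0.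
Proof.
move=> [p1 p2 p3 p4] lk km; apply: ron_shen_eq0l.
set n := pivot_row x _; have /andP[h1 h2] := pivot_rowP x (m0 + k%:Z).
have -> : p x n k' = p x n (m0 + k%:Z) - beta^-1 * (m0 + k%:Z - k')%:~R.
  by rewrite /ron_shen_point !intrD intrN; ring.
have k1 : l.+2%:R <= (m0 + k%:Z - k')%:~R :> R.
  by rewrite -[l.+2%:R]/((l.+2%:Z)%:~R) ler_int; clear -lk km; lia.
have : beta^-1 * l.+2%:R <= beta^-1 * (m0 + k%:Z - k')%:~R.
  by rewrite ler_pM2l ?invr_gt0.
have : 0 <= alpha * l.+1%:R by rewrite mulr_ge0// ltW.
move: p4 h2 alpha0 eps0; rewrite -/n -[l.+2%:R]natr1 !mulrBl mulrDr; lra.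
Qed.

(** Right propagation: once a block has been inverted, each further column is
    the last good one of its pivot row, whose entry there is bounded below and
    whose other entries lie in columns already controlled. *)
Lemma propagate (delta : R) (Lmax k : nat) : 0 < delta -> 0 <= B ->
  exists D : R, 0 <= D /\ forall (x : R) (n0 m0 : int) (l : nat)
      (v : int -> R[i]) (t : R) (Q : nat),
    (l <= Lmax)%N -> generic x -> full_block x n0 m0 l ->
    delta <= normc (\det (Mmx g alpha beta x n0 m0 l)) ->
    `|m0| <= Q%:Z -> `|m0 + l%:Z| <= Q%:Z -> `|m0 + k%:Z| <= Q%:Z -> 0 <= t ->
    (forall n m : int, m0 <= m <= m0 + (maxn k l)%:Z -> good a b alpha beta x n m ->
       normc (row_sum Q x v n) <= t) ->
    forall j : nat, (j <= k)%N -> normc (v (m0 + j%:Z)) <= D * t.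
Proof.
move=> delta0 B0.
pose C (l : nat) : R := delta^-1 * (l.+1%:R * (l`!%:R * B ^+ l)).
have C0 l : 0 <= C l by rewrite !mulr_ge0 ?exprn_ge0// invr_ge0 ltW.
pose C1 : R := \sum_(l < Lmax.+1) C l.
have CC1 l : (l <= Lmax)%N -> C l <= C1.
  rewrite -ltnS => lL; rewrite /C1 (bigD1 (Ordinal lL))//= lerDl.
  by rewrite sumr_ge0.
have blockP (x : R) (n0 m0 : int) (l : nat) (v : int -> R[i]) (t : R) (Q j : nat) : (l
  <= Lmax)%N -> generic x ->
    full_block x n0 m0 l ->
    delta <= normc (\det (Mmx g alpha beta x n0 m0 l)) ->
    `|m0| <= Q%:Z -> `|m0 + l%:Z| <= Q%:Z -> 0 <= t ->
    (forall n m : int, m0 <= m <= m0 + l%:Z -> good a b alpha beta x n m ->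
       normc (row_sum Q x v n) <= t) ->
    (j <= l)%N -> normc (v (m0 + j%:Z)) <= C1 * t.
  move=> lL gx blk dd m0Q mlQ t0 rows jl.
  have jl' : (j < l.+1)%N by [].
  have AB (i' j' : 'I_l.+1) : normc (Mmx g alpha beta x n0 m0 l i' j') <= B.
    by rewrite mxE; apply: g_bound; exact: gx.
  have := @normc_solve_le _ _ _ (\col_j v (m0 + (j : nat)%:Z)) _ _ t AB delta0 dd.
  move=> /(_ _ (Ordinal jl')); rewrite mxE/= => h; apply: le_trans (h _) _.
    move=> i'; rewrite -(block_row_sum (Q := Q) _ _ blk)//.
    apply: (rows _ (m0 + (i' : nat)%:Z)); first by have := ltn_ord i'; clear; lia.
    rewrite /good in_itv/= ron_shen_pointD; case: blk => p1 p2 p3 p4.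
    have i1 : (i' : nat)%:R <= l%:R :> R by rewrite ler_nat -ltnS.
    have e1 : 0 < beta^-1 - alpha by move: eps_beta eps0; lra.
    have : 0 <= (beta^-1 - alpha) * (i' : nat)%:R by rewrite mulr_ge0// ltW.
    have : (beta^-1 - alpha) * (i' : nat)%:R <= (beta^-1 - alpha) * l%:R.
      by rewrite ler_pM2l.
    rewrite mulrBl -!pmulrn; lra.
  by rewrite ler_wpM2r// CC1.
have C10 : 0 <= C1 by rewrite sumr_ge0.
elim: k => [|k [D [D0 IH]]].
  exists C1; split => // x n0 m0 l v t Q lL gx blk dd m0Q mlQ _ t0 rows j.
  rewrite leqn0 => /eqP ->.
  apply: (blockP x n0 m0 l v t Q) => // n m h; apply: (rows _ m) => //; clear -h; lia.
pose D' := eta^-1 * (1 + k.+1%:R * (B * D)).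
have D'0 : 0 <= D' by rewrite !(mulr_ge0, addr_ge0)// invr_ge0 ltW.
exists (C1 + D + D'); split; first by rewrite !addr_ge0.
move=> x n0 m0 l v t Q lL gx blk dd m0Q mlQ mkQ t0 rows j.
rewrite leq_eqVlt => /orP[/eqP ->|jk]; last first.
  rewrite (le_trans (y := D * t)) ?ler_wpM2r//; last by rewrite addrAC lerDr addr_ge0.
  apply: (IH x n0 m0 l v t Q) => //; first by clear -m0Q mkQ; lia.
  by move=> n m h; apply: (rows _ m) => //; clear -h; lia.
have [kl|lk] := leqP k.+1 l.
  rewrite (le_trans (y := C1 * t)) ?ler_wpM2r//; last by rewrite -addrA lerDl addr_ge0.
  apply: (blockP x n0 m0 l v t Q) => //.
  by move=> n m h; apply: (rows _ m) => //; clear -h kl; lia.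
rewrite (le_trans (y := D' * t)) ?ler_wpM2r//; last by rewrite lerDr addr_ge0.
set n := pivot_row x (m0 + k.+1%:Z).
have rn : normc (row_sum Q x v n) <= t.
  apply: (rows _ (m0 + k.+1%:Z)); first by clear; lia.
  have /andP[h1 h2] := pivot_rowP x (m0 + k.+1%:Z).
  by rewrite /good in_itv/=; apply/andP; split; move: h1 h2; rewrite -/n; move: eps_ba
    eps_beta eps0 alpha0; lra.
have rnE : row_sum Q x v n =
    \sum_(j < k.+1) ron_shen g alpha beta x n (m0 + (j : nat)%:Z) * v (m0 + (j : nat)%:Z)
    + ron_shen g alpha beta x n (m0 + k.+1%:Z) * v (m0 + k.+1%:Z).
  rewrite /row_sum (sum_symrange_window m0Q mkQ) ?big_ord_recr//.
  - by move=> k' k'm; rewrite (pivot_row_left blk) ?mul0r.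
  - by move=> k' k'm; rewrite pivot_row_right ?mul0r.
have eta_le : eta <= normc (ron_shen g alpha beta x n (m0 + k.+1%:Z)).
  apply: g_below; first exact: gx.
  have /andP[h1 h2] := pivot_rowP x (m0 + k.+1%:Z).
  by rewrite in_itv/=; apply/andP; split; move: h1 h2; rewrite -/n; move: eps_ba
    eps_beta eps0 alpha0; lra.
rewrite -mulrA ler_pdivlMl//.
rewrite (le_trans (ler_wpM2r (normc_ge0 _) eta_le))// -normcM.
move: rnE => /eqP; rewrite -subr_eq => /eqP rnE.
have -> : ron_shen g alpha beta x n (m0 + k.+1%:Z) * v (m0 + k.+1%:Z) =
   row_sum Q x v n + - \sum_(j < k.+1) ron_shen g alpha beta x n (m0 + (j : nat)%:Z) *
     v (m0 + (j : nat)%:Z).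
  by rewrite -rnE; ring.
rewrite (le_trans (le_normcD _ _))// mulrDl mul1r lerD// normcN.
rewrite (le_trans (normc_sum _ _ _))//.
rewrite (le_trans (y := \sum_(i < k.+1) B * (D * t)))//; last first.
  by rewrite sumr_const card_ord -[_ *+ _.+1]mulr_natl !mulrA.
apply: ler_sum => i _; rewrite normcM ler_pM ?normc_ge0//.
  by apply: g_bound; exact: gx.
apply: (IH x n0 m0 l v t Q) => //; first by clear -m0Q mkQ; lia.
  by move=> n' m' h; apply: (rows _ m') => //; clear -h; lia.
by rewrite -ltnS.
Qed.

End rows.

(** Any column lies at bounded distance to the right of an invertible block: move
    [x] along the column lattice until it meets the good interval modulo [alpha],
    take the block there, translate it back, and propagate to the column. *)
Lemma rows_control (R : realType) (a b alpha beta eps eta B c d delta : R)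
    (g : R -> R[i]) (N : set R) (nx mx : R -> int) (lx : R -> nat) :
  0 < alpha -> 0 < beta -> 0 < eps -> 0 < eta -> 0 <= B ->
  irrational (alpha * beta) ->
  alpha + 2 * eps <= b - a -> alpha + 2 * eps <= beta^-1 ->
  (forall x : R, x \notin `]a, b[ -> g x = 0) ->
  (forall x, ~ N x -> normc (g x) <= B) ->
  (forall x, ~ N x -> x \in `[a + eps, b - eps] -> eta <= normc (g x)) ->
  start_choice a b alpha beta nx mx ->
  (forall x : R, x \in `[0, alpha] ->
     biggest_l b alpha beta x (nx x) (mx x) (lx x)) ->
  c < d -> `]c, d[ `<=` `]0, alpha[ -> 0 < delta ->
  (forall x : R, x \in `]c, d[ ->
     delta <= normc (\det (Mmx g alpha beta x (nx x) (mx x) (lx x)))) ->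
  exists (C L : R) (Q0 : nat), 0 <= C /\ forall Q x, (Q0 <= Q)%N ->
    generic alpha beta N x -> forall (v : int -> R[i]) t, 0 <= t ->
    (forall n : int, `|x - alpha * n%:~R| <= L ->
       normc (row_sum alpha beta g Q x v n) <= t) ->
    normc (v 0) <= C * t.
Proof.
move=> alpha0 beta0 eps0 eta0 B0 irr eps_ba eps_beta g_supp g_bound g_below.
move=> [first_nm [K0 nmK]] big_l cd cdI delta0 detM.
have gam0 : 0 < beta^-1 by rewrite invr_gt0.
have irr' : irrational (alpha / beta^-1) by rewrite invrK.
have [S rec] := rotation_recurrence alpha0 gam0 irr' cd.
pose K := absz K0.
have e1 : 0 < beta^-1 - alpha by lra.
pose Lmax := Num.truncn ((b - a) / (beta^-1 - alpha)).
pose kmax := (S + K.*2)%N.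
have [D [D0 prop]] := propagate alpha0 beta0 eps0 eta0 eps_ba eps_beta g_supp
  g_bound g_below Lmax kmax delta0 B0.
pose Q0 := (kmax + Lmax)%N.
exists D, (`|a| + `|b| + beta^-1 * Q0%:R), Q0; split=> // Q x Q0Q gx v t t0 rows.
(* Starting [S + K] columns to the left ensures that the block begins at or
   before column 0, wherever in the range [[-K, K]] its own offset lies. *)
have [s [r [sS cyd]]] := rec (x - beta^-1 * (S + K)%:R).
pose s' : int := s%:Z - (S + K)%:Z.
pose y := ron_shen_point alpha beta x r s'.
have yE : y = x - beta^-1 * (S + K)%:R + beta^-1 * s%:R - alpha * r%:~R.
  by rewrite /y /s' /ron_shen_point intrB; ring.
rewrite -yE in cyd.
have y0a : y \in `[0, alpha].
  have /cdI : `]c, d[%classic y by rewrite /= in_itv.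
  by rewrite /= !in_itv/= => /andP[h1 h2]; rewrite !ltW.
have [ngood nfirst] := first_nm _ y0a.
have [nP nmax] := big_l _ y0a.
have [nK mK] := nmK _ y0a.
pose n0 := nx y + r; pose m0 := mx y + s'; pose l := lx y.
have pE n m : ron_shen_point alpha beta x (n + r) (m + s') =
    ron_shen_point alpha beta y n m by rewrite ron_shen_point_shift.
have blk : full_block a b alpha beta x n0 m0 l.
  rewrite /full_block pE.
  move: ngood; rewrite /good in_itv/= => /andP[pa pb].
  have diag (k : nat) : ron_shen_point alpha beta y (nx y + k%:Z) (mx y + k%:Z) =
      ron_shen_point alpha beta y (nx y) (mx y) + (beta^-1 - alpha) * k%:R.
    by rewrite ron_shen_pointD -!pmulrn; ring.
  split=> //.
  - have := nfirst (mx y - 1); rewrite ltrBlDr ltrDl ltr01 => /(_ isT).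
    rewrite /good in_itv/= -[nx y]addr0 ron_shen_pointD addr0.
    rewrite intrN mulr1z mulr0z; lra.
  - by rewrite -diag.
  - rewrite -diag leNgt; apply/negP => /nmax; rewrite /l.
    by rewrite ltnn.
have lL : (l <= Lmax)%N.
  case: blk => p1 p2 p3 p4.
  rewrite /Lmax truncn_ge_nat ?divr_ge0//; try lra.
  by rewrite ler_pdivlMr// mulrC; lra.
have ME : Mmx g alpha beta x n0 m0 l = Mmx g alpha beta y (nx y) (mx y) l.
  apply/matrixP => i j; rewrite !mxE /ron_shen -pE; congr g.
  by congr ron_shen_point; rewrite /n0 /m0; ring.
have dd : delta <= normc (\det (Mmx g alpha beta x n0 m0 l)).
  by rewrite ME; apply: detM; rewrite in_itv.
have m0kmax : 0 <= - m0 <= kmax%:Z.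
  by clear -mK sS; rewrite /m0 /s' /kmax; move: mK; rewrite /K; lia.
have := prop x n0 m0 l v t Q lL gx blk dd.
have -> : v 0 = v (m0 + (absz (- m0))%:Z).
  by congr v; clear -m0kmax; lia.
apply=> //; try by clear -m0kmax lL Q0Q; rewrite /Q0 in Q0Q; lia.
move=> n m mm gm; apply: rows; move: gm; rewrite /good in_itv/= /ron_shen_point.
have mQ : `|m| <= Q0%:Z.
  by clear -m0kmax lL mm; rewrite /Q0; lia.
have mQR : `|m%:~R| <= Q0%:R :> R by rewrite -intr_norm -[Q0%:R]/((Q0%:Z)%:~R) ler_int.
have : `|beta^-1 * m%:~R| <= beta^-1 * Q0%:R.
  by rewrite normrM gtr0_norm// ler_pM2l.
rewrite !ler_norml => /andP[h1 h2] /andP[h3 h4].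
have := ler_norm b; have := ler_norm (- a); rewrite normrN.
have := normr_ge0 a; have := normr_ge0 b.
by move=> *; apply/andP; split; lra.
Qed.


(** * Square-integrable functions and orthogonal families *)

Section square_integrable.
Context d (T : measurableType d) (R : realType) (mu : {measure set T -> \bar R}).
Implicit Types (D : set T) (f g : T -> R).

Definition sqint D f :=
  measurable_fun D f /\ mu.-integrable D (EFin \o (fun x => f x ^+ 2)).

Lemma integrable_le D f g : measurable D -> measurable_fun D f ->
  mu.-integrable D (EFin \o g) -> (forall x, D x -> `|f x| <= g x) ->
  mu.-integrable D (EFin \o f).
Proof.
move=> mD mf ig fg; apply: le_integrable ig => //.
  exact/measurable_EFinP.
by move=> x Dx /=; rewrite lee_fin (le_trans (fg x Dx))// ler_norm.
Qed.

Lemma integrableD_EFin D f g : measurable D ->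
  mu.-integrable D (EFin \o f) -> mu.-integrable D (EFin \o g) ->
  mu.-integrable D (EFin \o (fun x => f x + g x)).
Proof. by move=> mD fi gi; exact: (integrableD mD fi gi). Qed.

Lemma integrableZ_EFin D f (c : R) : measurable D ->
  mu.-integrable D (EFin \o f) -> mu.-integrable D (EFin \o (fun x => c * f x)).
Proof. by move=> mD fi; exact: (integrableZl mD c fi). Qed.

Lemma integrable_sum_EFin D (I : eqType) (s : seq I) (F : I -> T -> R) :
  measurable D -> (forall k, k \in s -> mu.-integrable D (EFin \o F k)) ->
  mu.-integrable D (EFin \o (fun x => \sum_(k <- s) F k x)).
Proof.
move=> mD; elim: s => [|k s IH] Fi.
  under eq_fun do rewrite big_nil.
  exact: integrable0.
under eq_fun do rewrite big_cons.
apply: integrableD_EFin => //; first by apply: Fi; rewrite mem_head.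
by apply: IH => j js; apply: Fi; rewrite inE js orbT.
Qed.

Lemma Rintegral_sum D (I : eqType) (s : seq I) (F : I -> T -> R) :
  measurable D -> (forall k, k \in s -> mu.-integrable D (EFin \o F k)) ->
  \int[mu]_(x in D) (\sum_(k <- s) F k x) = \sum_(k <- s) \int[mu]_(x in D) F k x.
Proof.
move=> mD; elim: s => [|k s IH] Fi.
  by rewrite big_nil; under eq_Rintegral do rewrite big_nil; rewrite Rintegral_cst// mul0r.
under eq_Rintegral do rewrite big_cons.
have Fs j : j \in s -> mu.-integrable D (EFin \o F j).
  by move=> js; apply: Fi; rewrite inE js orbT.
rewrite big_cons RintegralD ?IH//; first by apply: Fi; rewrite mem_head.
exact: integrable_sum_EFin.
Qed.

Lemma sqint_mul D f g : measurable D -> sqint D f -> sqint D g ->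
  mu.-integrable D (EFin \o (fun x => f x * g x)).
Proof.
move=> mD [mf fi] [mg gi].
apply: (integrable_le (g := fun x => f x ^+ 2 + g x ^+ 2)) => //.
- exact: measurable_funM.
- exact: integrableD_EFin.
- move=> x _; rewrite ler_norml; apply/andP; split; nra.
Qed.

Lemma sqintZ D f (c : R) : measurable D -> sqint D f -> sqint D (fun x => c * f x).
Proof.
move=> mD [mf fi]; split; first exact: measurable_funM.
under eq_fun do rewrite exprMn.
exact: integrableZ_EFin.
Qed.

Lemma sqintD D f g : measurable D -> sqint D f -> sqint D g ->
  sqint D (fun x => f x + g x).
Proof.
move=> mD sf sg; split; first by apply: measurable_funD; [exact: sf.1|exact: sg.1].
apply: (integrable_le (g := fun x => 2 * f x ^+ 2 + 2 * g x ^+ 2)) => //.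
- by apply: measurable_funX; apply: measurable_funD; [exact: sf.1|exact: sg.1].
- by apply: integrableD_EFin => //; apply: integrableZ_EFin => //;
  [exact: sf.2|exact: sg.2].
- move=> x _; rewrite ger0_norm ?sqr_ge0//; have := sqr_ge0 (f x - g x); nra.
Qed.

Lemma sqintB D f g : measurable D -> sqint D f -> sqint D g ->
  sqint D (fun x => f x - g x).
Proof.
move=> mD sf sg; under eq_fun do rewrite -mulN1r.
by apply: sqintD => //; exact: sqintZ.
Qed.

Lemma sqint0 D : sqint D (fun=> 0).
Proof.
split; first exact: measurable_cst.
by under eq_fun do rewrite expr0n/=; exact: integrable0.
Qed.

Lemma sqint_sum D (I : eqType) (s : seq I) (F : I -> T -> R) : measurable D ->
  (forall k, k \in s -> sqint D (F k)) -> sqint D (fun x => \sum_(k <- s) F k x).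
Proof.
move=> mD; elim: s => [|k s IH] Fi.
  under eq_fun do rewrite big_nil.
  exact: sqint0.
under eq_fun do rewrite big_cons.
apply: sqintD => //; first by apply: Fi; rewrite mem_head.
by apply: IH => j js; apply: Fi; rewrite inE js orbT.
Qed.

Lemma sqint_bounded D f (M : R) : measurable D -> (mu D < +oo)%E ->
  measurable_fun D f -> (forall x, D x -> `|f x| <= M) -> sqint D f.
Proof.
move=> mD Doo mf fM; split => //.
apply: (integrable_le (g := fun=> M ^+ 2)) => //.
- exact: measurable_funX.
- apply/integrableP; split; first exact/measurable_EFinP/measurable_cst.
  by rewrite integral_cst//= lte_mul_pinfty// lee_fin.
- move=> x Dx; rewrite ger0_norm ?sqr_ge0// -real_normK ?num_real//.
  by rewrite lerXn2r ?nnegrE// (le_trans _ (fM _ Dx)).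
Qed.

(** Triangle inequality for the square norm, up to a factor 2. *)
Lemma Rintegral_sqrB_le D f g h : measurable D -> sqint D f -> sqint D g ->
  sqint D h ->
  \int[mu]_(x in D) (f x - h x) ^+ 2 <=
  2 * \int[mu]_(x in D) (f x - g x) ^+ 2 + 2 * \int[mu]_(x in D) (g x - h x) ^+ 2.
Proof.
move=> mD sf sg sh.
have ifg := (sqintB mD sf sg).2; have igh := (sqintB mD sg sh).2.
rewrite -!RintegralZl// -RintegralD//; [|exact: integrableZ_EFin..].
apply: le_Rintegral => //; first exact: (sqintB mD sf sh).2.
  by apply: integrableD_EFin => //; exact: integrableZ_EFin.
move=> x _; have := sqr_ge0 ((f x - g x) - (g x - h x)); nra.
Qed.

Section orthogonal.
Variables (D : set T) (P : R) (e : int -> T -> R).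
Hypothesis mD : measurable D.
Hypothesis P0 : 0 < P.
Hypothesis se : forall k, sqint D (e k).
Hypothesis oe : forall j k, \int[mu]_(x in D) (e j x * e k x) = (j == k)%:R * P.

Lemma sqint_comb (s : seq int) (c : int -> R) :
  sqint D (fun x => \sum_(k <- s) c k * e k x).
Proof. by apply: sqint_sum => // k _; exact: sqintZ. Qed.

Lemma Rintegral_mul_comb f (s : seq int) (c : int -> R) : sqint D f ->
  \int[mu]_(x in D) (f x * \sum_(k <- s) c k * e k x) =
  \sum_(k <- s) c k * \int[mu]_(x in D) (f x * e k x).
Proof.
move=> sf; under eq_Rintegral do rewrite mulr_sumr.
have ife k : mu.-integrable D (EFin \o (fun x => f x * e k x)) by exact: sqint_mul.
rewrite Rintegral_sum//.
  apply: eq_bigr => k _; rewrite -RintegralZl//.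
  by apply: eq_Rintegral => x _; rewrite mulrCA.
by move=> k _; under eq_fun do rewrite mulrCA; exact: integrableZ_EFin.
Qed.

(** Completing the square: the residual is minimal when the coefficients are
    those of the orthogonal projection, and is then the defect in Parseval's
    identity. *)
Lemma Rintegral_sqr_residual f (s : seq int) (c : int -> R) : uniq s -> sqint D f ->
  \int[mu]_(x in D) (f x - \sum_(k <- s) c k * e k x) ^+ 2 =
  \int[mu]_(x in D) f x ^+ 2
  - P^-1 * \sum_(k <- s) (\int[mu]_(x in D) (f x * e k x)) ^+ 2
  + P * \sum_(k <- s) (c k - P^-1 * \int[mu]_(x in D) (f x * e k x)) ^+ 2.
Proof.
move=> us sf.
pose A k := \int[mu]_(x in D) (f x * e k x).
pose q x := \sum_(k <- s) c k * e k x.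
have sq : sqint D q by exact: sqint_comb.
have qe k : k \in s -> \int[mu]_(x in D) (q x * e k x) = P * c k.
  move=> ks; under eq_Rintegral do rewrite mulrC.
  rewrite Rintegral_mul_comb//.
  rewrite (bigD1_seq k)//= oe eqxx mul1r big1 ?addr0 1?mulrC// => j jk.
  by rewrite oe eq_sym (negbTE jk) mul0r mulr0.
have qq : \int[mu]_(x in D) (q x * q x) = P * \sum_(k <- s) c k ^+ 2.
  rewrite Rintegral_mul_comb// mulr_sumr big_seq [RHS]big_seq.
  by apply: eq_bigr => k ks; rewrite qe// expr2 mulrCA.
have fq : \int[mu]_(x in D) (f x * q x) = \sum_(k <- s) c k * A k.
  exact: Rintegral_mul_comb.
transitivity (\int[mu]_(x in D) (f x ^+ 2 + (-2 * (f x * q x) + q x * q x))).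
  by apply: eq_Rintegral => x _; rewrite -/(q x); ring.
have ifq := sqint_mul mD sf sq; have iqq := sqint_mul mD sq sq.
have ifq2 := integrableZ_EFin (-2) mD ifq.
rewrite RintegralD//; [|exact: sf.2|exact: integrableD_EFin].
rewrite RintegralD// RintegralZl// qq fq -addrA; congr (_ + _).
rewrite !mulr_sumr -big_split -sumrN -big_split/=.
by apply: eq_bigr => k _; rewrite -/(A k); field; rewrite gt_eqF// P0.
Qed.

Lemma bessel f (s : seq int) : uniq s -> sqint D f ->
  \sum_(k <- s) (\int[mu]_(x in D) (f x * e k x)) ^+ 2 <=
  P * \int[mu]_(x in D) f x ^+ 2.
Proof.
move=> us sf; rewrite -ler_pdivrMl//.
have := Rintegral_sqr_residual (fun k => P^-1 * \int[mu]_(x in D) (f x * e k x)) us sf.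
rewrite [X in _ + P * X]big1 ?mulr0 ?addr0; last by move=> k _; rewrite subrr expr0n.
move=> E; rewrite -subr_ge0 -E; apply: Rintegral_ge0 => x _; exact: sqr_ge0.
Qed.

(** The projection approximates at least as well as any given combination, so a
    good approximation by the system forces large coefficients. *)
Lemma parseval_approx f (s : seq int) (c : int -> R) : uniq s -> sqint D f ->
  P * \int[mu]_(x in D) f x ^+ 2 <=
  \sum_(k <- s) (\int[mu]_(x in D) (f x * e k x)) ^+ 2 +
  P * \int[mu]_(x in D) (f x - \sum_(k <- s) c k * e k x) ^+ 2.
Proof.
move=> us sf; rewrite Rintegral_sqr_residual//.
set S := \sum_(k <- s) _ ^+ 2; set J := \int[_]_(_ in _) _.
have U0 : 0 <= \sum_(k <- s) (c k - P^-1 * \int[mu]_(x in D) (f x * e k x)) ^+ 2.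
  by rewrite sumr_ge0// => k _; exact: sqr_ge0.
move: U0; set U := \sum_(k <- s) _ => U0.
have -> : S + P * (J - P^-1 * S + P * U) = P * J + P * (P * U).
  by field; rewrite gt_eqF// P0.
by rewrite lerDl !mulr_ge0// ltW.
Qed.

End orthogonal.
End square_integrable.


(** * The Hartley system on a period *)

Section hartley.
Context {R : realType}.
Local Notation mu := (@lebesgue_measure R).
Implicit Types (u beta x t : R) (j k : int).

Definition window u beta : set R := `[u, u + beta^-1].

Definition phase beta k x : R := 2 * pi * beta * k%:~R * x.

(** The real system [cos + sin], indexed by all integers, is orthogonal; it
    treats cosines and sines on the same footing. *)
Definition hartley beta k x : R := cos (phase beta k x) + sin (phase beta k x).

Lemma measurable_window u beta : measurable (window u beta : set (measurableTypeR R)).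
Proof. exact: measurable_itv. Qed.

Lemma measure_window u beta : 0 < beta -> mu (window u beta) = (beta^-1)%:E.
Proof.
move=> b0; rewrite /window lebesgue_measure_itv/= lte_fin ltrDl invr_gt0 b0.
by rewrite -EFinB addrAC subrr add0r.
Qed.

Lemma measure_window_fin u beta : 0 < beta -> (mu (window u beta) < +oo)%E.
Proof. by move=> b0; rewrite measure_window// ltry. Qed.

Lemma continuous_measurable_R (f : R -> R) (D : set R) :
  continuous f -> measurable_fun D f.
Proof. by move=> cf; apply: measurable_funTS; exact: continuous_measurable_fun. Qed.

Lemma continuous_affine (a c : R) : continuous (fun x : R => a * x + c).
Proof.
move=> x; apply: cvgD; last exact: cvg_cst.
by apply: cvgM; [exact: cvg_cst|exact: cvg_id].
Qed.

Lemma continuous_cos_affine (a c : R) : continuous (fun x : R => cos (a * x + c)).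
Proof.
move=> x; apply: continuous_comp; first exact: continuous_affine.
exact: continuous_cos.
Qed.

Lemma sin_periodZ t k : sin (t + 2 * pi * k%:~R) = sin t.
Proof.
have nat_case (s : R) (n : nat) : sin (s + 2 * pi * n%:R) = sin s.
  have -> : s + 2 * pi * n%:R = s + (pi *+ 2) *+ n.
    by rewrite -mulrnA -[_ *+ (2 * n)]mulr_natr natrM; ring.
  exact: (periodicn (@sinD2pi R)).
case: k => n; first exact: nat_case.
by rewrite NegzE intrN mulrN -(nat_case (t - _) n.+1) subrK.
Qed.

Lemma integral_cos_window u beta k (c : R) : 0 < beta -> k != 0 ->
  \int[mu]_(x in window u beta) cos (phase beta k x + c) = 0.
Proof.
move=> b0 k0; pose a := 2 * pi * beta * k%:~R.
have a0 : a != 0.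
  by rewrite /a !mulf_neq0// ?intr_eq0// ?gt_eqF ?pi_gt0.
pose F x := a^-1 * sin (a * x + c).
have dF x : is_derive x 1 F (cos (a * x + c)).
  rewrite /F; apply: is_derive_eq.
  by rewrite addr0 /GRing.scale/= mulr1 mulrCA mulVf ?mulr1.
have cF : continuous F.
  move=> x; apply: differentiable_continuous; apply/derivable1_diffP.
  exact: (@ex_derive _ _ _ _ _ _ _ (dF x)).
have := @continuous_FTC2 R (fun x => cos (a * x + c)) F u (u + beta^-1).
rewrite ltrDl invr_gt0 => /(_ b0 _ _ _) E.
rewrite /Rintegral /window /phase -/a E//.
- rewrite /F mulrDr -/a.
  have -> : a * beta^-1 = 2 * pi * k%:~R by rewrite /a; field; rewrite gt_eqF.
  by rewrite addrAC sin_periodZ -EFinB subrr.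
- by apply: continuous_subspaceT; exact: continuous_cos_affine.
- split; first by move=> x _; exact: (@ex_derive _ _ _ _ _ _ _ (dF x)).
  + by apply: cvg_at_right_filter; exact: cF.
  + by apply: cvg_at_left_filter; exact: cF.
- by move=> x _; rewrite derive1E; exact: (@derive_val _ _ _ _ _ _ _ (dF x)).
Qed.

Lemma integral_cos_windowE u beta k (c : R) : 0 < beta ->
  \int[mu]_(x in window u beta) cos (phase beta k x + c) =
  (k == 0)%:R * (cos c * beta^-1).
Proof.
move=> b0; case: eqVneq => [->|k0]; last by rewrite integral_cos_window// mul0r.
rewrite mul1r; under eq_Rintegral do rewrite /phase mulr0z mulr0 mul0r add0r.
transitivity (cos c * fine (mu (window u beta))); last by rewrite measure_window.
exact: (Rintegral_cst mu (measurable_window u beta) (cos c)).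
Qed.

Lemma integrable_cos_window u beta k (c : R) : 0 < beta ->
  mu.-integrable (window u beta) (EFin \o (fun x => cos (phase beta k x + c))).
Proof.
move=> b0; apply: continuous_compact_integrable; first exact: segment_compact.
by apply: continuous_subspaceT; exact: continuous_cos_affine.
Qed.

Lemma hartley_mul beta j k x : hartley beta j x * hartley beta k x =
  cos (phase beta (j - k) x + 0) + cos (phase beta (j + k) x + (- (pi / 2))).
Proof.
rewrite addr0 cosBpihalf /hartley.
have -> : phase beta (j - k) x = phase beta j x - phase beta k x.
  by rewrite /phase intrB; ring.
have -> : phase beta (j + k) x = phase beta j x + phase beta k x.
  by rewrite /phase intrD; ring.
by rewrite cosB sinD; ring.
Qed.

Lemma hartley_orthogonal u beta j k : 0 < beta ->
  \int[mu]_(x in window u beta) (hartley beta j x * hartley beta k x) =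
  (j == k)%:R * beta^-1.
Proof.
move=> b0; under eq_Rintegral do rewrite hartley_mul.
rewrite RintegralD; [|exact: measurable_window|exact: integrable_cos_window..].
rewrite !integral_cos_windowE// cos0 mul1r cosN cos_pihalf mul0r mulr0 addr0.
by rewrite subr_eq0.
Qed.

Lemma hartley_bound beta k x : `|hartley beta k x| <= 2.
Proof.
rewrite /hartley (le_trans (ler_normD _ _))// -[2]/(1 + 1).
by rewrite lerD ?cos_max ?sin_max.
Qed.

Lemma measurable_phase beta k D : measurable_fun D (phase beta k).
Proof. exact: measurable_funM. Qed.

Lemma measurable_cos_phase beta k D : measurable_fun D (fun x => cos (phase beta k x)).
Proof.
apply: measurable_funTS; apply: measurableT_comp => //; last exact: measurable_phase.
apply: continuous_measurable_fun; exact: continuous_cos.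
Qed.

Lemma measurable_sin_phase beta k D : measurable_fun D (fun x => sin (phase beta k x)).
Proof.
apply: measurable_funTS; apply: measurableT_comp => //; last exact: measurable_phase.
apply: continuous_measurable_fun; exact: continuous_sin.
Qed.

Lemma measurable_hartley beta k D : measurable_fun D (hartley beta k).
Proof.
by apply: measurable_funD;
  [exact: measurable_cos_phase|exact: measurable_sin_phase].
Qed.

Lemma sqint_hartley u beta k : 0 < beta -> sqint mu (window u beta) (hartley beta k).
Proof.
move=> b0; apply: (@sqint_bounded _ _ _ _ _ _ 2).
- exact: measurable_window.
- exact: measure_window_fin.
- exact: measurable_hartley.
- by move=> x _; exact: hartley_bound.
Qed.

(** * The Fejer kernel *)

(** Unnormalised Fejer kernel: [n] times the usual one. *)
Definition fejer n t : R :=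
  (\sum_(m < n) cos (m%:R * t)) ^+ 2 + (\sum_(m < n) sin (m%:R * t)) ^+ 2.

Lemma fejer_ge0 n t : 0 <= fejer n t.
Proof. by rewrite addr_ge0// sqr_ge0. Qed.

(** Multiplying the two sums by the rotation of angle [t] makes them telescope. *)
Lemma fejer_telescope n t : 2 * (1 - cos t) * fejer n t = 2 * (1 - cos (n%:R * t)).
Proof.
pose C := \sum_(m < n) cos (m%:R * t); pose S := \sum_(m < n) sin (m%:R * t).
have E1 : (1 - cos t) * C + sin t * S = 1 - cos (n%:R * t).
  rewrite /C /S; elim: n {C S} => [|n IH].
    by rewrite !big_ord0 mul0r cos0 !mulr0 subrr addr0.
  rewrite !big_ord_recr/= !mulrDr addrACA IH.
  have -> : n.+1%:R * t = n%:R * t + t by rewrite -natr1 mulrDl mul1r.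
  rewrite cosD; ring.
have E2 : (1 - cos t) * S - sin t * C = - sin (n%:R * t).
  rewrite /C /S; elim: n {C S E1} => [|n IH].
    by rewrite !big_ord0 mul0r sin0 !mulr0 subr0 oppr0.
  rewrite !big_ord_recr/= !mulrDr opprD addrACA IH.
  have -> : n.+1%:R * t = n%:R * t + t by rewrite -natr1 mulrDl mul1r.
  rewrite sinD; ring.
have h1 := cos2Dsin2 t; have h2 := cos2Dsin2 (n%:R * t).
have -> : 2 * (1 - cos t) = (1 - cos t) ^+ 2 + sin t ^+ 2.
  by rewrite sin2cos2; ring.
rewrite /fejer -/C -/S.
have -> : ((1 - cos t) ^+ 2 + sin t ^+ 2) * (C ^+ 2 + S ^+ 2) =
  ((1 - cos t) * C + sin t * S) ^+ 2 + ((1 - cos t) * S - sin t * C) ^+ 2 by ring.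
by rewrite E1 E2 sqrrN sin2cos2; ring.
Qed.

(** Each product on the right is a cosine of the difference plus a sine of the
    sum; the sines cancel between [(i, j)] and [(j, i)]. *)
Lemma fejer_hartley n beta x y : fejer n (phase beta 1 x - phase beta 1 y) =
  \sum_(i < n) \sum_(j < n)
    hartley beta ((i : nat)%:Z - (j : nat)%:Z) x *
    hartley beta ((i : nat)%:Z - (j : nat)%:Z) y.
Proof.
pose t := phase beta 1 x - phase beta 1 y.
pose s := phase beta 1 x + phase beta 1 y.
have tE k : phase beta k x - phase beta k y = k%:~R * t.
  by rewrite /t /phase; ring.
have sE k : phase beta k x + phase beta k y = k%:~R * s.
  by rewrite /s /phase; ring.
have E (i j : nat) : hartley beta (i%:Z - j%:Z) x * hartley beta (i%:Z - j%:Z) y =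
   cos (i%:R * t - j%:R * t) + sin (i%:R * s - j%:R * s).
  rewrite -!mulrBl.
  have -> : i%:R - j%:R = (i%:Z - j%:Z)%:~R :> R by rewrite intrB.
  rewrite -tE -sE /hartley cosB sinD; ring.
under eq_bigr do under eq_bigr do rewrite E cosB sinB.
rewrite /fejer -/t !expr2 !mulr_suml -big_split/=.
under [RHS]eq_bigr do rewrite !big_split sumrN/=.
rewrite !big_split/= sumrN.
rewrite [X in _ = _ + (X - _)]exchange_big/=.
have -> : \sum_(j < n) \sum_(i < n) sin (i%:R * s) * cos (j%:R * s) =
   \sum_(i < n) \sum_(j < n) cos (i%:R * s) * sin (j%:R * s) :> R.
  by apply: eq_bigr => i _; apply: eq_bigr => j _; rewrite mulrC.
rewrite subrr addr0; congr (_ + _).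
  by apply: eq_bigr => i _; rewrite mulr_sumr.
by apply: eq_bigr => i _; rewrite mulr_sumr.
Qed.

End hartley.


(** * Completeness of the Hartley system *)

Lemma dominated_small d (T : measurableType d) (R : realType)
    (mu : {measure set T -> \bar R}) (D : set T) (phi : nat -> T -> R) (G : T -> R) :
  measurable D -> (forall n, measurable_fun D (phi n)) ->
  (forall n x, D x -> 0 <= phi n x <= G x) -> mu.-integrable D (EFin \o G) ->
  {ae mu, forall x, D x -> forall eps, 0 < eps ->
    exists N, forall n, (N <= n)%N -> phi n x <= eps} ->
  forall eps, 0 < eps -> exists n, \int[mu]_(x in D) phi n x <= eps.
Proof.
move=> mD mphi phiG iG phi0 eps eps0.
have [||||] := @dominated_convergence _ _ _ mu D mD (fun n => EFin \o phi n)
  (cst 0%E) (EFin \o G) _ _ _ iG.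
- by move=> n; exact/measurable_EFinP.
- exact: measurable_cst.
- apply: filterS phi0 => x h Dx; apply/fine_cvgP; split; first exact: nearW.
  apply/cvgrPdist_le => e e0; have [N hN] := h Dx _ e0.
  exists N => // n /= Nn; rewrite /= sub0r normrN ger0_norm ?hN//.
  by have /andP[] := phiG n x Dx.
- apply: aeW => x n Dx /=; rewrite lee_fin.
  by have /andP[p0 pG] := phiG n x Dx; rewrite ger0_norm.
move=> _ _; rewrite integral0 => /fine_cvgP[_] /cvgrPdist_le /(_ _ eps0)[N _ hN].
exists N; have := hN N (leqnn N); rewrite /= sub0r normrN.
exact: le_trans (ler_norm _).
Qed.

Section density.
Context {R : realType}.
Local Notation mu := (@lebesgue_measure R).
Implicit Types (u beta x t : R) (j k : int) (f g : R -> R).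

Definition hcoef u beta f k := \int[mu]_(x in window u beta) (f x * hartley beta k x).

(** Unnormalised Fejer mean: the convolution of [f] with [fejer n] over a window. *)
Definition fejer_mean u beta n f x := \sum_(i < n) \sum_(j < n)
  hcoef u beta f ((i : nat)%:Z - (j : nat)%:Z) *
  hartley beta ((i : nat)%:Z - (j : nat)%:Z) x.

(** The summands are grouped according to the value of [i - j]. *)
Lemma fejer_mean_comb u beta n f : exists c : int -> R,
  forall x, fejer_mean u beta n f x = \sum_(k <- symrange n) c k * hartley beta k x.
Proof.
exists (fun k => (\sum_(i < n) \sum_(j < n) (k == (i : nat)%:Z - (j : nat)%:Z)%:R) *
  hcoef u beta f k) => x.
under [RHS]eq_bigr do rewrite -mulrA mulr_suml.
rewrite exchange_big/=; apply: eq_bigr => i _.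
under [RHS]eq_bigr do rewrite mulr_suml.
rewrite exchange_big/=; apply: eq_bigr => j _.
rewrite (bigD1_seq ((i : nat)%:Z - (j : nat)%:Z)) ?symrange_uniq//=.
  by rewrite eqxx mul1r big1 ?addr0// => k kij; rewrite (negbTE kij) mul0r.
by rewrite mem_symrange; have := ltn_ord i; have := ltn_ord j; clear; lia.
Qed.

Lemma fejer_meanE u beta n f x : 0 < beta -> sqint mu (window u beta) f ->
  fejer_mean u beta n f x = \int[mu]_(y in window u beta)
    (f y * fejer n (phase beta 1 x - phase beta 1 y)).
Proof.
move=> b0 sf; have mW := measurable_window u beta.
have ih k : mu.-integrable (window u beta) (EFin \o (fun y => f y * hartley beta k y)).
  by apply: sqint_mul => //; exact: sqint_hartley.
under eq_Rintegral do rewrite fejer_hartley mulr_sumr.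
rewrite Rintegral_sum//; last first.
  move=> i _; under eq_fun do rewrite mulr_sumr.
  apply: integrable_sum_EFin => // j _.
  by under eq_fun do rewrite mulrCA; exact: integrableZ_EFin.
apply: eq_bigr => i _.
under eq_Rintegral do rewrite mulr_sumr.
rewrite Rintegral_sum//; last first.
  by move=> j _; under eq_fun do rewrite mulrCA; exact: integrableZ_EFin.
apply: eq_bigr => j _.
under eq_Rintegral do rewrite mulrCA.
by rewrite RintegralZl// mulrC.
Qed.

Lemma sqint_fejer u beta n x : 0 < beta ->
  sqint mu (window u beta) (fun y => fejer n (phase beta 1 x - phase beta 1 y)).
Proof.
move=> b0; have mW := measurable_window u beta.
under eq_fun do rewrite fejer_hartley.
by do 2 (apply: sqint_sum => // ? _); apply: sqintZ => //; exact: sqint_hartley.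
Qed.

Lemma hartley0 beta x : hartley beta 0 x = 1.
Proof. by rewrite /hartley /phase mulr0z mulr0 mul0r cos0 sin0 addr0. Qed.

Lemma sqint_cst u beta (c : R) : 0 < beta -> sqint mu (window u beta) (fun=> c).
Proof.
move=> b0; apply: (@sqint_bounded _ _ _ _ _ _ `|c|) => //.
- exact: measurable_window.
- exact: measure_window_fin.
Qed.

Lemma integral_fejer u beta n x : 0 < beta ->
  \int[mu]_(y in window u beta) fejer n (phase beta 1 x - phase beta 1 y) =
  n%:R * beta^-1.
Proof.
move=> b0; transitivity (fejer_mean u beta n (fun=> 1) x).
  rewrite fejer_meanE//; last exact: sqint_cst.
  by apply: eq_Rintegral => y _; rewrite mul1r.
rewrite /fejer_mean -[n%:R]mulr_natl -[X in X%:R]card_ord -sumr_const.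
rewrite mulr1 mulr_suml; apply: eq_bigr => i _.
have hE k : hcoef u beta (fun=> 1) k = (k == 0)%:R * beta^-1.
  rewrite /hcoef -(hartley_orthogonal u k 0 b0).
  by apply: eq_Rintegral => y _; rewrite hartley0 mulr1 mul1r.
rewrite (bigD1 i)//= subrr hE eqxx hartley0 mulr1 big1 ?addr0// => j ji.
rewrite hE subr_eq0 eqz_nat eq_sym.
by rewrite (negbTE (_ : (nat_of_ord j != i))) ?mul0r.
Qed.

Lemma cos_le_away (tau t : R) : 0 < tau <= pi -> tau <= `|t| <= 2 * pi - tau ->
  cos t <= cos tau.
Proof.
move=> /andP[tau0 taupi] /andP[t1 t2]; rewrite -(cos_norm t).
have mono (s : R) : tau <= s <= pi -> cos s <= cos tau.
  move=> /andP[]; rewrite le_eqVlt => /predU1P[->//|ts spi]; apply: ltW.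
  by rewrite ltr_cos// in_itv/= ?spi ?taupi ?(ltW tau0)// ltW// (lt_trans tau0).
have [tpi|pit] := leP `|t| pi; first by apply: mono; rewrite t1.
have -> : cos `|t| = cos (2 * pi - `|t|).
  rewrite -[RHS]cosN opprB addrC -[LHS](periodicn (@cosD2pi R) 0) mulr0n addr0.
  rewrite -[RHS](cosD2pi); congr cos; rewrite -mulr_natl; ring.
by apply: mono; apply/andP; split; lra.
Qed.

(** Near [x] the oscillation of [f] is at most [eps]; elsewhere in the window the
    phase stays away from the multiples of the period, so the kernel is bounded
    independently of [n], and this part disappears after division by [n].  This
    needs [x] in the interior of the window, as [f] need not be periodic. *)
Lemma fejer_mean_cvg u beta f (B : R) x (eps : R) : 0 < beta -> continuous f ->
  (forall y, window u beta y -> `|f y| <= B) ->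
  u < x < u + beta^-1 -> 0 < eps ->
  exists C : R, forall n, `|fejer_mean u beta n f x - n%:R * beta^-1 * f x| <=
    eps * (n%:R * beta^-1) + C.
Proof.
move=> b0 cf fB /andP[ux xu] eps0; have mW := measurable_window u beta.
have bi0 : 0 < beta^-1 by rewrite invr_gt0.
have B0 : 0 <= B by apply: le_trans (fB u _) => //; rewrite /window/= in_itv/= lexx
  lerDl ltW.
have sf : sqint mu (window u beta) f.
  apply: (@sqint_bounded _ _ _ _ _ _ B) => //; first exact: measure_window_fin.
  exact: continuous_measurable_R.
(* [dl] comes from the continuity of [f]; [dl'] also keeps clear of the copies
   of [x] one period away. *)
have [dl dl0 fdl] : exists2 dl : R, 0 < dl &
    forall y : R, `|x - y| < dl -> `|f y - f x| <= eps.
  have /cvgrPdist_le/(_ _ eps0) := cf x.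
  move=> /nbhs_ballP[r r0 hr]; exists r => // y xy.
  by rewrite distrC; apply: hr.
pose dl' : R := Num.min dl (Num.min (x - u) (u + beta^-1 - x)).
have dl'0 : 0 < dl' by rewrite /dl' !lt_min dl0/=; apply/andP; split; lra.
have [dl1 dl2 dl3] : [/\ dl' <= dl, dl' <= x - u & dl' <= u + beta^-1 - x].
  by rewrite /dl' !ge_min !lexx !orbT.
pose tau := 2 * pi * beta * dl'.
have pi0 := @pi_gt0 R.
have c0 : 0 < 2 * pi * beta by rewrite !mulr_gt0.
have tau0 : 0 < tau by rewrite mulr_gt0.
have taupi : tau <= pi.
  have : 2 * dl' <= beta^-1 by lra.
  rewrite -(ler_pM2l c0); have -> : 2 * pi * beta / beta = 2 * pi by rewrite mulfK// gt_eqF.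
  by rewrite /tau; lra.
have cost1 : cos tau < 1.
  by rewrite -cos0 ltr_cos// in_itv/= ?lexx ?pi_ge0// (ltW tau0).
exists (2 * B * (2 / (1 - cos tau)) * beta^-1) => n.
pose Kn y := fejer n (phase beta 1 x - phase beta 1 y).
have sK : sqint mu (window u beta) Kn by exact: sqint_fejer.
have intK : \int[mu]_(y in window u beta) Kn y = n%:R * beta^-1 by exact: integral_fejer.
have s1 := sqint_cst u 1 b0.
have iK : mu.-integrable (window u beta) (EFin \o Kn).
  have := sqint_mul mW s1 sK.
  by under eq_fun do rewrite mul1r.
have sfx : sqint mu (window u beta) (fun y => f y - f x).
  by apply: sqintB => //; exact: sqint_cst.
have ifxK := sqint_mul mW sfx sK.
have ifK := sqint_mul mW sf sK.
have -> : n%:R * beta^-1 * f x = \int[mu]_(y in window u beta) (f x * Kn y).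
  by rewrite RintegralZl// intK mulrC.
rewrite fejer_meanE// -RintegralB//; last exact: integrableZ_EFin.
rewrite -/Kn -intK.
have -> : \int[mu]_(y in window u beta) (f y * Kn y - f x * Kn y) =
    \int[mu]_(y in window u beta) ((f y - f x) * Kn y).
  by apply: eq_Rintegral => y _; rewrite mulrBl.
rewrite (le_trans (le_normr_Rintegral _ ifxK))//.
have iC c : mu.-integrable (window u beta) (EFin \o (fun=> c)).
  have := sqint_mul mW s1 (sqint_cst u c b0).
  by under eq_fun do rewrite mul1r.
pose C := 2 * B * (2 / (1 - cos tau)).
apply: (@le_trans _ _ (\int[mu]_(y in window u beta) (eps * Kn y + C))); last first.
  rewrite RintegralD//; last exact: integrableZ_EFin.
  rewrite RintegralZl// lerD2l le_eqVlt; apply/orP; left; apply/eqP.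
  transitivity (C * fine (mu (window u beta))); last by rewrite measure_window.
  exact: Rintegral_cst.
apply: le_Rintegral => //.
- exact: integrable_norm.
- by apply: integrableD_EFin => //; exact: integrableZ_EFin.
move=> y Wy; have K0 : 0 <= Kn y by exact: fejer_ge0.
rewrite normrM (ger0_norm K0).
have tc : 0 < 1 - cos tau by rewrite subr_gt0.
have C0 : 0 <= C by rewrite !mulr_ge0// ?divr_ge0// ltW.
have [xy|xy] := ltP `|x - y| dl.
  by rewrite (le_trans (y := eps * Kn y)) ?lerDl// ler_wpM2r// fdl.
rewrite (le_trans (y := C))//; last by rewrite lerDr mulr_ge0// ltW.
apply: ler_pM => //.
  rewrite (le_trans (ler_normB _ _))// mulr_natl mulr2n lerD ?fB//.
  by rewrite /window/= in_itv/= !ltW.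
set t := phase beta 1 x - phase beta 1 y.
have tE : t = 2 * pi * beta * (x - y) by rewrite /t /phase mulr1z; ring.
have tt : tau <= `|t| <= 2 * pi - tau.
  rewrite tE normrM (gtr0_norm c0) /tau ler_pM2l// (le_trans dl1 xy)/=.
  have -> : 2 * pi - 2 * pi * beta * dl' = 2 * pi * beta * (beta^-1 - dl').
    by field; rewrite gt_eqF.
  rewrite ler_pM2l// ler_norml.
  move: Wy; rewrite /window/= in_itv/= => /andP[y1 y2].
  by apply/andP; split; lra.
have ct := cos_le_away (_ : 0 < tau <= pi) tt.
have {}ct : cos t <= cos tau by apply: ct; rewrite tau0.
rewrite ler_pdivlMr//.
have := fejer_telescope n t; rewrite -/(Kn y).
have := cos_geN1 (n%:R * t).
have : (1 - cos tau) * Kn y <= (1 - cos t) * Kn y by rewrite ler_wpM2r// lerD2l lerN2.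
by move: (Kn y) => k; lra.
Qed.

(** [f] belongs to the closed span of the system in the square norm of the window. *)
Definition hartley_dense u beta f := forall eps : R, 0 < eps ->
  exists (M : nat) (c : int -> R), \int[mu]_(x in window u beta)
    (f x - \sum_(k <- symrange M) c k * hartley beta k x) ^+ 2 <= eps.

Lemma hartley_dense_closed u beta f : 0 < beta -> sqint mu (window u beta) f ->
  (forall eps : R, 0 < eps -> exists g, [/\ sqint mu (window u beta) g,
     hartley_dense u beta g &
     \int[mu]_(x in window u beta) (f x - g x) ^+ 2 <= eps]) ->
  hartley_dense u beta f.
Proof.
move=> b0 sf fg eps eps0; have mW := measurable_window u beta.
have e4 : 0 < eps / 4 by rewrite divr_gt0.
have [g [sg dg fge]] := fg _ e4; have [M [c gc]] := dg _ e4.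
exists M, c.
apply: le_trans (Rintegral_sqrB_le mW sf sg _) _; last by lra.
by apply: sqint_comb => // k; exact: sqint_hartley.
Qed.

Lemma negligible_endpoints u v : mu.-negligible [set u; v].
Proof.
exists [set u; v]; split => //; first exact: measurableU.
by apply: countable_lebesgue_measure0; exact: finite_set_countable.
Qed.

(** The Fejer means converge at every interior point and are bounded by the bound
    of [f], so they converge in the square norm. *)
Lemma hartley_dense_continuous u beta f (B : R) : 0 < beta -> continuous f ->
  (forall y, window u beta y -> `|f y| <= B) -> hartley_dense u beta f.
Proof.
move=> b0 cf fB eps eps0; have mW := measurable_window u beta.
have bi0 : 0 < beta^-1 by rewrite invr_gt0.
have B0 : 0 <= B by apply: le_trans (fB u _) => //; rewrite /window/= in_itv/= lexx
  lerDl ltW.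
have sf : sqint mu (window u beta) f.
  apply: (@sqint_bounded _ _ _ _ _ _ B) => //; first exact: measure_window_fin.
  exact: continuous_measurable_R.
pose w n : R := n.+1%:R * beta^-1.
have w0 n : 0 < w n by rewrite mulr_gt0.
pose s n x := (w n)^-1 * fejer_mean u beta n.+1 f x.
have ms n : measurable_fun (window u beta) (s n).
  apply: measurable_funM => //; apply: measurable_sum => i; apply: measurable_sum => j.
  by apply: measurable_funM => //; exact: measurable_hartley.
have sB n x : `|s n x| <= B.
  rewrite normrM gtr0_norm ?invr_gt0// ler_pdivrMl//.
  have sK : sqint mu (window u beta) (fun y => fejer n.+1 (phase beta 1 x - phase beta
    1 y)).
    exact: sqint_fejer.
  have iK := sqint_mul mW (sqint_cst u 1 b0) sK.
  have ifK := sqint_mul mW sf sK.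
  rewrite fejer_meanE// (le_trans (le_normr_Rintegral _ ifK))//.
  rewrite mulrC /w -(integral_fejer u n.+1 x b0) -RintegralZl//; last first.
    by move: iK; under eq_fun do rewrite mul1r.
  apply: le_Rintegral => //; first exact: integrable_norm.
    apply: integrableZ_EFin => //.
    by move: iK; under eq_fun do rewrite mul1r.
  move=> y Wy; rewrite normrM (ger0_norm (fejer_ge0 _ _)).
  by rewrite ler_wpM2r ?fejer_ge0// fB.
have [||||m hm] := @dominated_small _ _ _ mu _ (fun n x => (f x - s n x) ^+ 2)
    (fun=> (2 * B) ^+ 2) mW _ _ _ _ _ eps0.
- move=> n; apply: measurable_funX; apply: measurable_funB; last exact: ms.
  exact: continuous_measurable_R.
- move=> n x Wx; rewrite sqr_ge0/= -[X in X <= _]real_normK ?num_real//.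
  rewrite lerXn2r ?nnegrE ?mulr_ge0// (le_trans (ler_normB _ _))//.
  by rewrite mulr_natl mulr2n lerD// fB.
- have := sqint_mul mW (sqint_cst u 1 b0) (sqint_cst u ((2 * B) ^+ 2) b0).
  by under eq_fun do rewrite mul1r.
- apply: negligibleS (negligible_endpoints u (u + beta^-1)) => x /= h.
  apply: contrapT => /not_orP[xu xb]; apply: h => Wx e e0.
  have {Wx xu xb} xW : u < x < u + beta^-1.
    move: Wx; rewrite /window/= in_itv/= !le_eqVlt => /andP[/predU1P[E|->]].
      by case: xu.
    by move=> /predU1P[E|->//]; case: xb.
  pose r := Num.min 1 e.
  have r0 : 0 < r by rewrite /r lt_min ltr01.
  have r2 : 0 < r / 2 by rewrite divr_gt0.
  have [C hC] := fejer_mean_cvg b0 cf fB xW r2.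
  exists (Num.truncn (2 * C / (r * beta^-1))) => n Nn.
  have /= wn : C <= r / 2 * w n.
    have h1 : 2 * C / (r * beta^-1) < n.+1%:R.
      rewrite (lt_le_trans (truncnS_gt _))// ler_nat//.
    move: h1; rewrite ltr_pdivrMr ?mulr_gt0// /w => h1.
    by rewrite -(ler_pM2l (_ : 0 < 2))// ltW// (lt_le_trans h1)//; lra.
  have h : `|f x - s n x| <= r.
    rewrite distrC -(ler_pM2l (w0 n)) -[X in X * `|_|](gtr0_norm (w0 n)) -normrM.
    rewrite mulrBr /s mulrA mulfV ?gt_eqF// mul1r (le_trans (hC n.+1))// -/(w n).
    by move: wn; lra.
  rewrite -real_normK ?num_real//.
  have r1 : r <= 1 /\ r <= e by rewrite /r !ge_min !lexx orbT.
  case: r1 => r1 re; have := normr_ge0 (f x - s n x); nra.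
have [c hc] := fejer_mean_comb u beta m.+1 f.
exists m.+1, (fun k => (w m)^-1 * c k).
move: hm; rewrite (_ : (fun x => (f x - s m x) ^+ 2) =
  (fun x => (f x - \sum_(k <- symrange m.+1) (w m)^-1 * c k * hartley beta k x) ^+ 2))//.
apply/funext => x; rewrite /s hc mulr_sumr; congr ((_ - _) ^+ 2).
by apply: eq_bigr => k _; rewrite mulrA.
Qed.

(** Clamping to [[-B, B]] is a 1-Lipschitz retraction, so it may be applied to
    an approximant of a function already taking values there. *)
Definition clamp (B t : R) := Num.max (- B) (Num.min B t).

Lemma clamp_bound (B t : R) : 0 <= B -> `|clamp B t| <= B.
Proof.
move=> B0; rewrite ler_norml /clamp le_max lexx/= ge_max; apply/andP; split; first lra.
by rewrite ge_min lexx.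
Qed.

Lemma clamp_id (B t : R) : `|t| <= B -> clamp B t = t.
Proof.
rewrite ler_norml => /andP[t1 t2]; rewrite /clamp.
by rewrite (min_idPr _)// (max_idPr _).
Qed.

Lemma clamp_lip (B s t : R) : 0 <= B -> `|clamp B s - clamp B t| <= `|s - t|.
Proof.
move=> B0; have N1 := ler_norm (s - t); have N2 := ler_norm (t - s).
rewrite distrC in N2; rewrite ler_norml /clamp.
have E : Num.max (- B) B = B by apply/max_idPr; lra.
have [h1|h1] := ltP B s; have [h2|h2] := ltP B t;
  have [h3|h3] := ltP (- B) s; have [h4|h4] := ltP (- B) t;
  by rewrite ?E; apply/andP; split; lra.
Qed.

Lemma clamp_residual (B t : R) : 0 <= B -> `|t - clamp B t| <= `|t|.
Proof.
move=> B0; have N1 := ler_norm t; have N2 := ler_norm (- t).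
rewrite normrN in N2; rewrite ler_norml /clamp.
have [h1|h1] := ltP B t; have [h3|h3] := ltP (- B) t;
  have [h5|h5] := ltP (- B) B; by apply/andP; split; lra.
Qed.

Lemma continuous_clamp (B : R) f : 0 <= B -> continuous f ->
  continuous (fun x => clamp B (f x)).
Proof.
move=> B0 cf x; apply/cvgrPdist_le => e e0.
have /cvgrPdist_le/(_ _ e0) := cf x.
by apply: filterS => y; apply: le_trans; exact: clamp_lip.
Qed.

Lemma measurable_clamp (B : R) D f : measurable (D : set (measurableTypeR R)) ->
  measurable_fun D f -> measurable_fun D (fun x => clamp B (f x)).
Proof.
move=> mD mf; apply: measurable_maxr; first exact: measurable_cst.
by apply: measurable_minr => //; exact: measurable_cst.
Qed.

(** Approximate [f] by continuous functions in mean, then clamp them: between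
    functions bounded by [B] the square distance is at most [2 B] times the mean
    distance. *)
Lemma hartley_dense_bounded u beta f (B : R) : 0 < beta ->
  measurable_fun [set: measurableTypeR R] f -> (forall y, `|f y| <= B) ->
  hartley_dense u beta f.
Proof.
move=> b0 mf fB; have mW := measurable_window u beta.
have B0 : 0 <= B := le_trans (normr_ge0 _) (fB 0).
have mWf : measurable_fun (window u beta) f by exact: measurable_funTS.
have sf : sqint mu (window u beta) f.
  by apply: (@sqint_bounded _ _ _ _ _ _ B) => //; exact: measure_window_fin.
apply: hartley_dense_closed => // eps eps0.
have if1 : mu.-integrable (window u beta) (EFin \o f).
  have := sqint_mul mW sf (sqint_cst u 1 b0).
  by under eq_fun do rewrite mulr1.
have [h_ [ch ih hcvg]] :=
  approximation_continuous_integrable mW (measure_window_fin u b0) if1.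
pose e := eps / (2 * B + 1).
have e0 : 0 < e by rewrite divr_gt0// ltr_wpDl// mulr_ge0.
move/fine_cvgP : hcvg => [hfin] /cvgrPdist_le/(_ _ e0) hle.
have [N _ hN] := filterI hfin hle.
have [{}hfin {}hle] := hN N (leqnn N).
pose h := h_ N; pose g x := clamp B (h x).
have cg : continuous g by apply: continuous_clamp => //; exact: ch.
have gB y : `|g y| <= B by exact: clamp_bound.
have sg : sqint mu (window u beta) g.
  apply: (@sqint_bounded _ _ _ _ _ _ B) => //; first exact: measure_window_fin.
  exact: continuous_measurable_R.
have ifh : mu.-integrable (window u beta) (EFin \o (fun x => `|f x - h x|)).
  apply: integrable_norm; have := integrableB mW if1 (ih N).
  by under eq_fun do rewrite /= -EFinB.
exists g; split => //; first by apply: (hartley_dense_continuous b0 cg) => y _.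
apply: (@le_trans _ _ (\int[mu]_(x in window u beta) (2 * B * `|f x - h x|))).
  apply: le_Rintegral => //; first exact: (sqintB mW sf sg).2.
    exact: integrableZ_EFin.
  move=> x _; have h1 : `|f x - g x| <= `|f x - h x|.
    by rewrite -{1}(clamp_id (fB x)); exact: clamp_lip.
  have h2 : `|f x - g x| <= 2 * B.
    by rewrite (le_trans (ler_normB _ _))// mulr_natl mulr2n lerD.
  rewrite -real_normK ?num_real// expr2.
  by rewrite ler_pM.
rewrite RintegralZl//.
have : \int[mu]_(x in window u beta) `|f x - h x| <= e.
  by move: hle; rewrite /= sub0r normrN; exact: le_trans (ler_norm _).
have D0 : 0 < 2 * B + 1 by rewrite ltr_wpDl// mulr_ge0.
rewrite /e ler_pdivlMr// => he.
have : 0 <= \int[mu]_(x in window u beta) `|f x - h x| by apply: Rintegral_ge0.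
by move: he; lra.
Qed.

Lemma hartley_dense_sqint u beta f : 0 < beta -> measurable_fun [set: measurableTypeR
  R] f ->
  sqint mu (window u beta) f -> hartley_dense u beta f.
Proof.
move=> b0 mf sf; have mW := measurable_window u beta.
apply: hartley_dense_closed => // eps eps0.
have mc n : measurable_fun (window u beta) (fun x => clamp n%:R (f x)).
  by apply: measurable_clamp => //; exact: measurable_funTS.
have sc n : sqint mu (window u beta) (fun x => clamp n%:R (f x)).
  apply: (@sqint_bounded _ _ _ _ _ _ n%:R) => //; first exact: measure_window_fin.
  - exact: mc.
  - by move=> x _; exact: clamp_bound.
have [||||n hn] := @dominated_small _ _ _ mu _
    (fun n x => (f x - clamp n%:R (f x)) ^+ 2) (fun x => f x ^+ 2) mW _ _ _ _ _ eps0.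
- by move=> n; apply: measurable_funX; exact: (sqintB mW sf (sc n)).1.
- move=> n x Wx; rewrite sqr_ge0/= -[X in X <= _]real_normK ?num_real//.
  rewrite -[X in _ <= X]real_normK ?num_real//.
  by rewrite lerXn2r ?nnegrE// clamp_residual.
- exact: sf.2.
- apply: aeW => x _ e e0; exists (Num.truncn `|f x|).+1 => n Nn.
  rewrite clamp_id ?subrr ?expr0n ?ltW//.
  by rewrite (lt_le_trans (truncnS_gt _))// ler_nat.
exists (fun x => clamp n%:R (f x)); split => //.
apply: (@hartley_dense_bounded _ _ _ n%:R) => // [|y]; last exact: clamp_bound.
exact: measurable_clamp.
Qed.

Lemma hartley_bessel u beta f M : 0 < beta -> sqint mu (window u beta) f ->
  \sum_(k <- symrange M) hcoef u beta f k ^+ 2 <=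
  beta^-1 * \int[mu]_(x in window u beta) f x ^+ 2.
Proof.
move=> b0 sf; apply: (bessel (measurable_window u beta)) => //.
- by rewrite invr_gt0.
- by move=> k; exact: sqint_hartley.
- by move=> j k; exact: hartley_orthogonal.
- exact: symrange_uniq.
Qed.

Lemma ler_sum_subset (I : eqType) (r r' : seq I) (F : I -> R) : uniq r -> uniq r' ->
  {subset r <= r'} -> (forall i, 0 <= F i) ->
  \sum_(i <- r) F i <= \sum_(i <- r') F i.
Proof.
move=> ur ur' rr' F0; rewrite [leRHS](bigID [in r])/= -[X in _ <= X + _]big_filter.
have -> : \sum_(i <- [seq i <- r' | i \in r]) F i = \sum_(i <- r) F i.
  apply: perm_big; apply: uniq_perm; rewrite ?filter_uniq//.
  by move=> k; rewrite mem_filter; case: (boolP (k \in r)) => //= /rr'.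
by rewrite lerDl sumr_ge0.
Qed.

Lemma hartley_parseval u beta f (eps : R) : 0 < beta ->
  measurable_fun [set: measurableTypeR R] f ->
  sqint mu (window u beta) f -> 0 < eps ->
  exists M0, forall M, (M0 <= M)%N ->
  beta^-1 * \int[mu]_(x in window u beta) f x ^+ 2 <=
  \sum_(k <- symrange M) hcoef u beta f k ^+ 2 + eps.
Proof.
move=> b0 mf sf eps0.
have be0 : 0 < beta * eps by rewrite mulr_gt0.
have [M0 [c hc]] := hartley_dense_sqint b0 mf sf be0.
exists M0 => M M0M.
have bi0 : 0 < beta^-1 by rewrite invr_gt0.
have := parseval_approx (measurable_window u beta) bi0
  (fun k => sqint_hartley u k b0) (fun j k => hartley_orthogonal u j k b0) c
  (symrange_uniq M0) sf.
move=> h; apply: (le_trans h); apply: lerD.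
  apply: ler_sum_subset; rewrite ?symrange_uniq// => k; last exact: sqr_ge0.
  by rewrite !mem_symrange; move: M0M; clear; lia.
by rewrite ler_pdivrMl.
Qed.

End density.


(** * Periodization *)

Section periodization.
Context {R : realType}.
Local Notation mu := (@lebesgue_measure R).
Local Notation borel f := (measurable_fun [set: measurableTypeR R] f).
Implicit Types (u beta x s : R) (k : int) (f : R -> R).

Lemma measurable_translation s :
  measurable_fun setT (fun x : measurableTypeR R => x + s : measurableTypeR R).
Proof. exact: measurable_funD. Qed.

Lemma borel_translate (f : R -> R) s : borel f -> borel (fun x => f (x + s)).
Proof. by move=> mf; apply: measurableT_comp => //; exact: measurable_translation. Qed.

Lemma lebesgue_measure_translate s (A : set (measurableTypeR R)) : measurable A ->
  pushforward mu (fun x : measurableTypeR R => x + s : measurableTypeR R) A = mu A.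
Proof.
move=> mA; apply/esym.
have ms : measurable_fun setT (fun x : measurableTypeR R => x + s : measurableTypeR R).
  exact: measurable_translation.
apply: (@lebesgue_measure_unique _ (pushforward mu (fun x : measurableTypeR R => x + s
  : measurableTypeR R))) => //= _ [[c d]] _ <-.
rewrite /pushforward.
have -> : (fun x => x + s) @^-1` `]c, d] = `]c - s, d - s]%classic.
  by apply/seteqP; split => x /=; rewrite !in_itv/= => /andP[h1 h2]; apply/andP; split; lra.
rewrite !lebesgue_measure_itv/= !lte_fin ltrD2r.
by case: ifP => // _; rewrite -!EFinB; congr EFin; ring.
Qed.

Lemma ge0_integral_translate (f : R -> \bar R) s : borel f -> (forall x, 0 <= f x)%E ->
  (\int[mu]_x f (x + s)%R = \int[mu]_x f x)%E.
Proof.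
move=> mf f0; rewrite -[LHS](ge0_integral_pushforward (measurable_translation s) mu (D
  := setT))//.
apply: (eq_measure_integral mu) => [|? A mA _]; first exact: measurable_translation.
exact: (lebesgue_measure_translate s mA).
Qed.

Lemma integrable_translate f s : borel f -> mu.-integrable [set: measurableTypeR R]
  (EFin \o f) ->
  mu.-integrable [set: measurableTypeR R] (EFin \o (fun x => f (x + s))).
Proof.
move=> mf /integrableP[_ fi]; apply/integrableP; split.
  by apply/measurable_EFinP; exact: borel_translate.
move: fi; rewrite -(ge0_integral_translate s)//.
by apply: measurableT_comp => //; exact/measurable_EFinP.
Qed.

Lemma Rintegral_translate f s : borel f -> mu.-integrable [set: measurableTypeR R]
  (EFin \o f) ->
  \int[mu]_x f (x + s) = \int[mu]_x f x.
Proof.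
move=> mf fi; rewrite /Rintegral; congr fine.
have := @integral_pushforward _ _ _ _ R _ (measurable_translation s) mu setT (EFin \o f).
move=> /(_ (proj2 (measurable_EFinP _ _) mf) (integrable_translate s mf fi) measurableT).
rewrite preimage_setT => <-.
apply: (eq_measure_integral mu) => [|? A mA _]; first exact: measurable_translation.
exact: (lebesgue_measure_translate s mA).
Qed.

Definition periodize beta Q f x := \sum_(k <- symrange Q) f (x + beta^-1 * k%:~R).

(** The support lies in the [2 Q + 1] periods centred on the window at [u], the
    ones that [periodize] folds onto it. *)
Definition supported_near u beta Q f := forall x, f x != 0 ->
  u - Q%:R * beta^-1 <= x < u + Q.+1%:R * beta^-1.

Lemma sum_restrict_cells u beta Q f x : 0 < beta -> supported_near u beta Q f ->
  \sum_(k <- symrange Q)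
    (f \_ `[u + beta^-1 * k%:~R, u + beta^-1 * k%:~R + beta^-1[) x = f x.
Proof.
move=> b0 fu; have bi0 : 0 < beta^-1 by rewrite invr_gt0.
have [fx0|fx0] := eqVneq (f x) 0.
  by rewrite big1 // => k _; rewrite patchE; case: ifP.
have /andP[x1 x2] := fu x fx0.
pose j := Num.floor ((x - u) * beta).
have /andP[j1 j2] : j%:~R * beta^-1 <= x - u < (j%:~R + 1) * beta^-1.
  rewrite ler_pdivrMr// ltr_pdivlMr// floor_le/=.
  by have := floorD1_gt ((x - u) * beta); rewrite intrD.
have jQ : j \in symrange Q.
  rewrite mem_symrange ler_norml -ltzD1 -(ltr_int R) -(ler_int R) intrD intrN.
  apply/andP; split.
    rewrite -(ltr_pM2r bi0); apply: le_lt_trans j2.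
    by rewrite mulNr -!pmulrn; lra.
  rewrite ler_int -ltzD1 -(ltr_int R) intrD -(ltr_pM2r bi0).
  by apply: (le_lt_trans j1); move: x2; rewrite -!pmulrn -natr1; lra.
rewrite (bigD1_seq j) ?symrange_uniq//= patchE mem_set; last first.
  by rewrite /= in_itv/=; apply/andP; split; lra.
rewrite big1 ?addr0// => k kj; rewrite patchE; case: ifPn => //.
rewrite inE/= in_itv/= => /andP[k1 k2]; exfalso; move/negP: kj; apply.
have kb1 : k%:~R * beta^-1 < (j + 1)%:~R * beta^-1 by rewrite intrD; lra.
have kb2 : j%:~R * beta^-1 < (k + 1)%:~R * beta^-1 by rewrite intrD; lra.
move: kb1 kb2; rewrite !ltr_pM2r// !ltr_int !ltzD1 => h1 h2.
by rewrite eq_le h1 h2.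
Qed.

Lemma integrable_restrict_EFin f (D : set (measurableTypeR R)) : measurable D ->
  mu.-integrable [set: measurableTypeR R] (EFin \o f) ->
  mu.-integrable [set: measurableTypeR R] (EFin \o (f \_ D)).
Proof.
move=> mD fi; have mf : borel f.
  by have /integrableP[/measurable_EFinP] := fi.
apply: (@integrable_le _ (measurableTypeR R) R mu setT (f \_ D) (fun x => `|f x|)) => //.
- by apply/(measurable_restrictT _ mD); exact: measurable_funTS.
- exact: integrable_norm.
- by move=> x _; rewrite patchE; case: ifP; rewrite ?normr0.
Qed.

(** Translation moves the period in which a copy of [f] is read onto the window;
    the finitely many periods that matter cover the support. *)
Lemma integral_periodize u beta Q f : 0 < beta -> borel f ->
  mu.-integrable [set: measurableTypeR R] (EFin \o f) -> supported_near u beta Q f ->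
  \int[mu]_(x in window u beta) periodize beta Q f x = \int[mu]_x f x.
Proof.
move=> b0 mf fi fu.
have mW := measurable_window u beta.
have it k : mu.-integrable [set: measurableTypeR R] (EFin \o (fun x => f (x + beta^-1 *
  k%:~R))).
  exact: integrable_translate.
have iW k : mu.-integrable (window u beta) (EFin \o (fun x => f (x + beta^-1 * k%:~R))).
  exact: integrableS (it k).
have mI s : measurable (`[u + s, u + s + beta^-1[%classic : set (measurableTypeR R)).
  exact: measurable_itv.
rewrite Rintegral_sum//.
transitivity (\sum_(k <- symrange Q)
  \int[mu]_x (f \_ `[u + beta^-1 * k%:~R, u + beta^-1 * k%:~R + beta^-1[) x).
  apply: eq_bigr => k _; set s := beta^-1 * k%:~R.
  rewrite /window -Rintegral_itv_bndo_bndc; last first.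
    by apply: integrableS (it k).
  rewrite Rintegral_mkcond -[RHS](Rintegral_translate s); last 2 first.
    by apply/(measurable_restrictT f (mI s)); exact: measurable_funTS.
    exact: integrable_restrict_EFin.
  apply: eq_Rintegral => x _; rewrite !patchE; congr (if _ then _ else _).
  by apply/idP/idP; rewrite !inE/= !in_itv/= => /andP[h1 h2]; apply/andP; split; lra.
rewrite -Rintegral_sum//; last by move=> k _; exact: integrable_restrict_EFin.
by apply: eq_Rintegral => x _; exact: sum_restrict_cells.
Qed.

Lemma sqint_periodize u beta Q f : 0 < beta -> borel f ->
  sqint mu [set: measurableTypeR R] f ->
  sqint mu (window u beta) (periodize beta Q f).
Proof.
move=> b0 mf [_ f2]; have mW := measurable_window u beta.
apply: sqint_sum => // k _; split.
  by apply: measurable_funTS; exact: borel_translate.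
have := @integrable_translate (fun x => f x ^+ 2) (beta^-1 * k%:~R) _ f2.
by move=> h; apply: integrableS (h _) => //; exact: measurable_funX.
Qed.

Lemma borel_periodize beta Q f : borel f -> borel (periodize beta Q f).
Proof. by move=> mf; apply: measurable_sum => k; exact: borel_translate. Qed.

(** Cauchy-Schwarz against the constant 1. *)
Lemma sqr_sum_le (I : Type) (r : seq I) (F : I -> R) :
  (\sum_(k <- r) F k) ^+ 2 <= (size r)%:R * \sum_(k <- r) F k ^+ 2.
Proof.
elim: r => [|k r IH]; first by rewrite !big_nil expr0n mulr0.
rewrite !big_cons/= -natr1.
set S := \sum_(j <- r) F j in IH *; set T := \sum_(j <- r) F j ^+ 2 in IH *.
have T0 : 0 <= T by rewrite sumr_ge0// => j _; exact: sqr_ge0.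
have [n0|n0] := eqVneq (size r)%:R (0 : R).
  by move: IH; rewrite n0; nra.
have n1 : 0 < (size r)%:R :> R by rewrite lt_neqAle eq_sym n0 ler0n.
have h := sqr_ge0 ((size r)%:R * F k - S).
have : 2 * F k * S <= (size r)%:R * F k ^+ 2 + T.
  rewrite -(ler_pM2l n1); nra.
nra.
Qed.

Lemma integral_sqr_periodize_le u beta Q f : 0 < beta -> borel f ->
  sqint mu [set: measurableTypeR R] f -> supported_near u beta Q f ->
  \int[mu]_(x in window u beta) periodize beta Q f x ^+ 2 <=
  Q.*2.+1%:R * \int[mu]_x f x ^+ 2.
Proof.
move=> b0 mf sf fu; have mW := measurable_window u beta.
have f2u : supported_near u beta Q (fun x => f x ^+ 2).
  by move=> x; rewrite expf_eq0/=; exact: fu.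
have mf2 : borel (fun x => f x ^+ 2) by exact: measurable_funX.
rewrite -(integral_periodize b0 mf2 sf.2 f2u) -RintegralZl//; last first.
  apply: integrable_sum_EFin => // k _.
  by apply: integrableS (integrable_translate _ mf2 sf.2).
apply: le_Rintegral => //.
- exact: (sqint_periodize u Q b0 mf sf).2.
- apply: integrableZ_EFin => //; apply: integrable_sum_EFin => // k _.
  by apply: integrableS (integrable_translate _ mf2 sf.2).
- by move=> x _; rewrite -size_symrange; exact: sqr_sum_le.
Qed.

(** * Fourier coefficients of a compactly supported function *)

Definition cosint beta f k := \int[mu]_x (f x * cos (phase beta k x)).
Definition sinint beta f k := \int[mu]_x (f x * sin (phase beta k x)).

Lemma cosintN beta f k : cosint beta f (- k) = cosint beta f k.
Proof.
apply: eq_Rintegral => x _; congr (_ * _); rewrite /phase intrN -[RHS]cosN.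
by congr cos; ring.
Qed.

Lemma periodize_mul beta Q f k x : 0 < beta ->
  periodize beta Q (fun y => f y * hartley beta k y) x =
  periodize beta Q f x * hartley beta k x.
Proof.
move=> b0; rewrite /periodize mulr_suml; apply: eq_bigr => j _; congr (_ * _).
have E : phase beta k (x + beta^-1 * j%:~R) = phase beta k x + 2 * pi * (k * j)%:~R.
  by rewrite /phase intrM; field; rewrite gt_eqF.
rewrite /hartley E sin_periodZ; congr (_ + _).
by rewrite -!sinDpihalf addrAC sin_periodZ.
Qed.

(** On a bounded set [|f| <= f^2 + 1]. *)
Lemma supported_integrable u beta Q f :
  sqint mu [set: measurableTypeR R] f -> supported_near u beta Q f ->
  mu.-integrable [set: measurableTypeR R] (EFin \o f).
Proof.
move=> [mf f2] fu.
pose I := `[u - Q%:R * beta^-1, u + Q.+1%:R * beta^-1[%classic : set (measurableTypeR R).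
have iI : mu.-integrable [set: measurableTypeR R] (EFin \o (\1_I : R -> R)).
  exact: integrable_indic_itv.
apply: (@integrable_le _ (measurableTypeR R) R mu setT f (fun x => f x ^+ 2 + \1_I x))
  => //.
  exact: integrableD_EFin.
move=> x _; have [->|fx0] := eqVneq (f x) 0.
  by rewrite normr0 addr_ge0// sqr_ge0.
rewrite indicE mem_set/=; last by rewrite /I/= in_itv/=; exact: fu.
by rewrite -(real_normK (num_real (f x))); have := normr_ge0 (f x); nra.
Qed.

Lemma integrable_mul_bounded f (h : R -> R) : borel h -> (forall x, `|h x| <= 1) ->
  mu.-integrable [set: measurableTypeR R] (EFin \o f) ->
  mu.-integrable [set: measurableTypeR R] (EFin \o (fun x => f x * h x)).
Proof.
move=> mh h1 fi; have mf : borel f by have /integrableP[/measurable_EFinP] := fi.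
apply: (@integrable_le _ (measurableTypeR R) R mu setT (fun x => f x * h x) (fun x =>
  `|f x|)) => //.
- exact: measurable_funM.
- exact: integrable_norm.
- by move=> x _; rewrite normrM ler_piMr.
Qed.

Lemma integrable_mul_cos beta f k : mu.-integrable [set: measurableTypeR R] (EFin \o f) ->
  mu.-integrable [set: measurableTypeR R] (EFin \o (fun x => f x * cos (phase beta k x))).
Proof.
apply: integrable_mul_bounded; first exact: measurable_cos_phase.
by move=> x; exact: cos_max.
Qed.

Lemma integrable_mul_sin beta f k : mu.-integrable [set: measurableTypeR R] (EFin \o f) ->
  mu.-integrable [set: measurableTypeR R] (EFin \o (fun x => f x * sin (phase beta k x))).
Proof.
apply: integrable_mul_bounded; first exact: measurable_sin_phase.
by move=> x; exact: sin_max.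
Qed.

Lemma sinintN beta f k : mu.-integrable [set: measurableTypeR R] (EFin \o f) ->
  sinint beta f (- k) = - sinint beta f k.
Proof.
move=> fi; have is_ := integrable_mul_sin beta k fi.
rewrite /sinint -[RHS]mulN1r -(RintegralZl _ _ is_)//.
apply: eq_Rintegral => x _; rewrite /phase intrN mulN1r -mulrN -sinN.
by congr (_ * sin _); ring.
Qed.

Lemma hcoef_periodize u beta Q f k : 0 < beta ->
  sqint mu [set: measurableTypeR R] f -> supported_near u beta Q f ->
  hcoef u beta (periodize beta Q f) k = cosint beta f k + sinint beta f k.
Proof.
move=> b0 sf fu; have fi := supported_integrable sf fu.
have ic := integrable_mul_cos beta k fi; have is_ := integrable_mul_sin beta k fi.
have E x : f x * hartley beta k x =
    f x * cos (phase beta k x) + f x * sin (phase beta k x) by rewrite -mulrDr.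
rewrite /hcoef -RintegralD//.
transitivity (\int[mu]_x (f x * hartley beta k x)); last by apply: eq_Rintegral.
rewrite -(integral_periodize (u := u) (Q := Q) b0).
- by apply: eq_Rintegral => x _; rewrite periodize_mul.
- by apply: measurable_funM; [exact: sf.1|exact: measurable_hartley].
- under eq_fun do rewrite E.
  exact: integrableD_EFin.
- by move=> x; rewrite mulf_eq0 negb_or => /andP[fx0 _]; exact: fu.
Qed.

(** Fourier coefficient of the complex function with real part [U] and
    imaginary part [V]. *)
Definition fcoef beta (U V : R -> R) k : R[i] :=
  Complex (cosint beta U k + sinint beta V k) (cosint beta V k - sinint beta U k).

(** The cross terms are odd in the frequency, so they cancel in a symmetric sum. *)
Lemma sum_sqr_fcoef u beta Q (U V : R -> R) M : 0 < beta ->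
  sqint mu [set: measurableTypeR R] U -> supported_near u beta Q U ->
  sqint mu [set: measurableTypeR R] V -> supported_near u beta Q V ->
  \sum_(k <- symrange M) normc (fcoef beta U V k) ^+ 2 =
  \sum_(k <- symrange M) hcoef u beta (periodize beta Q U) k ^+ 2 +
  \sum_(k <- symrange M) hcoef u beta (periodize beta Q V) k ^+ 2.
Proof.
move=> b0 sU Uu sV Vu; under eq_bigr do rewrite sqr_normcE.
rewrite -big_split/=; apply/eqP; rewrite -subr_eq0 -sumrB.
apply/eqP; apply: sum_symrange_odd => k.
have iU := supported_integrable sU Uu; have iV := supported_integrable sV Vu.
rewrite !(hcoef_periodize _ b0 sU Uu) !(hcoef_periodize _ b0 sV Vu).
rewrite !cosintN (sinintN beta k iU) (sinintN beta k iV).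
by ring.
Qed.

Lemma finite_set_uniq (I : choiceType) (X : set I) : finite_set X ->
  exists2 r : seq I, uniq r & X = [set` r].
Proof.
move=> /finite_seqP[r ->]; exists (undup r); first exact: undup_uniq.
by apply/seteqP; split => k /=; rewrite mem_undup.
Qed.

Lemma esum_symrange_ge (F : int -> R) M : (forall k, 0 <= F k) ->
  ((\sum_(k <- symrange M) F k)%:E <= \esum_(k in [set: int]) (F k)%:E)%E.
Proof.
move=> F0; apply: esum_ge; exists [set` symrange M].
  by split => //; exact: finite_seq.
by rewrite -fsbig_seq ?symrange_uniq// sumEFin.
Qed.

Lemma esum_symrange_le (F : int -> R) (C : \bar R) : (forall k, 0 <= F k) ->
  (forall M, ((\sum_(k <- symrange M) F k)%:E <= C)%E) ->
  (\esum_(k in [set: int]) (F k)%:E <= C)%E.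
Proof.
move=> F0 FC; apply: ge_ereal_sup => _ [X [/finite_set_uniq[r ur ->] _] <-].
apply: le_trans (FC (\max_(k <- r) absz k)%N).
rewrite -fsbig_seq// sumEFin lee_fin; apply: ler_sum_subset => //.
  exact: symrange_uniq.
move=> k kr; rewrite mem_symrange -abszE lez_nat.
exact: (@leq_bigmax_seq _ r xpredT absz k kr isT).
Qed.

Lemma esum_fcoef_ge u beta Q (U V : R -> R) : 0 < beta ->
  sqint mu [set: measurableTypeR R] U -> supported_near u beta Q U ->
  sqint mu [set: measurableTypeR R] V -> supported_near u beta Q V ->
  ((beta^-1 * (\int[mu]_(x in window u beta) periodize beta Q U x ^+ 2 +
             \int[mu]_(x in window u beta) periodize beta Q V x ^+ 2))%:E <=
  \esum_(k in [set: int]) (normc (fcoef beta U V k) ^+ 2)%:E)%E.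
Proof.
move=> b0 sU Uu sV Vu; apply/lee_addgt0Pr => e e0.
have e2 : 0 < e / 2 by rewrite divr_gt0.
have [M1 h1] := hartley_parseval b0 (borel_periodize beta Q sU.1)
  (sqint_periodize u Q b0 sU.1 sU) e2.
have [M2 h2] := hartley_parseval b0 (borel_periodize beta Q sV.1)
  (sqint_periodize u Q b0 sV.1 sV) e2.
pose M := maxn M1 M2.
apply: (@le_trans _ _ ((\sum_(k <- symrange M) normc (fcoef beta U V k) ^+ 2)%:E + e%:E)%E).
  rewrite -EFinD lee_fin (sum_sqr_fcoef M b0 sU Uu sV Vu).
  have := h1 M (leq_maxl _ _); have := h2 M (leq_maxr _ _); lra.
by rewrite leeD2r// esum_symrange_ge// => k; exact: sqr_ge0.
Qed.

Lemma esum_fcoef_le u beta Q (U V : R -> R) : 0 < beta ->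
  sqint mu [set: measurableTypeR R] U -> supported_near u beta Q U ->
  sqint mu [set: measurableTypeR R] V -> supported_near u beta Q V ->
  (\esum_(k in [set: int]) (normc (fcoef beta U V k) ^+ 2)%:E <=
   (beta^-1 * (Q.*2.+1%:R * \int[mu]_x (U x ^+ 2 + V x ^+ 2)))%:E)%E.
Proof.
move=> b0 sU Uu sV Vu; apply: esum_symrange_le => [k|M]; first exact: sqr_ge0.
rewrite lee_fin (sum_sqr_fcoef M b0 sU Uu sV Vu).
have bi0 : 0 < beta^-1 by rewrite invr_gt0.
rewrite (RintegralD measurableT sU.2 sV.2) !mulrDr; apply: lerD.
  rewrite (le_trans (hartley_bessel M b0 (sqint_periodize u Q b0 sU.1 sU)))//.
  by rewrite ler_pM2l// integral_sqr_periodize_le//; exact: sU.1.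
rewrite (le_trans (hartley_bessel M b0 (sqint_periodize u Q b0 sV.1 sV)))//.
by rewrite ler_pM2l// integral_sqr_periodize_le//; exact: sV.1.
Qed.

End periodization.


(** * Borel representatives of Lebesgue measurable functions *)

Section borel_representative.
Context {R : realType}.
Local Notation mu := (@lebesgue_measure R).
Local Notation cmu := (@leb R).
Local Notation borel f := (measurable_fun [set: measurableTypeR R] f).

Lemma measurable_borel_leb (A : set (measurableTypeR R)) : measurable A ->
  measurable (A : set (lebR R)).
Proof. exact: sub_caratheodory. Qed.

Lemma measurable_id_leb :
  measurable_fun [set: lebR R] (fun x : lebR R => x : measurableTypeR R).
Proof. by move=> _ A mA; rewrite setTI; exact: measurable_borel_leb. Qed.

Lemma ge0_integral_leb (f : R -> \bar R) : borel f -> (forall x, 0 <= f x)%E ->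
  (\int[cmu]_x f x = \int[mu]_x f x)%E.
Proof.
move=> mf f0; rewrite -[LHS](ge0_integral_pushforward measurable_id_leb cmu (D := setT))//.
Qed.

Lemma Rintegral_leb (f : R -> R) : borel f -> \int[cmu]_x f x = \int[mu]_x f x.
Proof.
move=> mf; rewrite /Rintegral; congr fine.
have mf' : borel (EFin \o f) by exact/measurable_EFinP.
rewrite integralE [RHS]integralE; congr (_ - _)%E.
  by rewrite -ge0_integral_leb//; exact: measurable_funepos.
by rewrite -ge0_integral_leb//; exact: measurable_funeneg.
Qed.

Lemma leb_measurableP (A : set (lebR R)) : measurable A ->
  exists B Z : set (measurableTypeR R),
    [/\ measurable B, measurable Z, mu Z = 0%E, B `<=` A & A `\` B `<=` Z].
Proof.
move=> mA.
have : (completed_algebra_gen mu).-sigma.-measurable A.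
  by rewrite completed_caratheodory_measurable.
rewrite g_sigma_completed_algebra_genE => -[B mB [Z0 [Z [mZ Z0' ZZ]]] <-].
exists B, Z; split => //.
by move=> x [[//|/ZZ]].
Qed.

Lemma leb_aeP (P : set R) : {ae cmu, forall x, P x} ->
  exists N : set (measurableTypeR R), [/\ measurable N, mu N = 0%E & forall x, ~ N x ->
    P x].
Proof.
move=> [A [mA A0 PA]]; have [B [Z [mB mZ Z0 BA ABZ]]] := leb_measurableP mA.
exists (B `|` Z); split; first exact: measurableU.
- have B0 : mu B = 0%E.
    apply/eqP; rewrite eq_le measure_ge0 andbT -[X in (_ <= X)%E]A0.
    exact: le_outer_measure.
  by rewrite null_set_setU.
- move=> x /not_orP[nB nZ]; apply: contrapT => nP; apply: nZ; apply: ABZ; split => //.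
  exact: PA.
Qed.

(** Each superlevel set of rational height is Borel up to a null set; [f] becomes
    Borel once set to zero on all these null sets.  Allowing any larger Borel
    set [N'] lets several conditions be imposed off the same null set. *)
Lemma borel_representative (f : R -> R) :
  measurable_fun [set: lebR R] (f : lebR R -> R) ->
  exists N : set (measurableTypeR R), [/\ measurable N, mu N = 0%E &
   forall N' : set (measurableTypeR R), measurable N' -> N `<=` N' ->
     borel (fun x => if x \in N' then 0 else f x)].
Proof.
move=> mf.
have mfq (q : rat) : measurable ([set x | ratr q < f x] : set (lebR R)).
  have := mf measurableT `]ratr q, +oo[%classic (measurable_itv _).
  by rewrite setTI; congr (measurable _); apply/seteqP; split => x /=; rewrite in_itv/=
    andbT.
pose BZ q := cid (leb_measurableP (mfq q)).
pose B q := sval (BZ q).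
pose Z q := sval (cid (svalP (BZ q))).
have BZP q : [/\ measurable (B q), measurable (Z q), mu (Z q) = 0%E,
    B q `<=` [set x | ratr q < f x] & [set x | ratr q < f x] `\` B q `<=` Z q].
  exact: svalP (cid (svalP (BZ q))).
pose Z' := \bigcup_(q : rat) Z q.
have mZ' : measurable Z' by apply: bigcupT_measurable_rat => q; have [] := BZP q.
exists Z'; split => //.
  pose Zn n := if unpickle n is Some q then Z q else set0.
  have mZn n : measurable (Zn n).
    by rewrite /Zn; case: unpickle => [q|//]; have [] := BZP q.
  have ZZn : Z' `<=` \bigcup_n Zn n.
    move=> y [q _ Zy]; exists (pickle q); first exact: I.
    by rewrite /Zn pickleK; exact: Zy.
  apply/eqP; rewrite eq_le measure_ge0 andbT.
  rewrite (le_trans (measure_sigma_subadditive _ _ mZ' ZZn))//.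
  rewrite eseries0// => n _ _; rewrite /Zn.
  by case: unpickle => [q|]; [have [] := BZP q|rewrite measure0].
move=> N mN ZN.
move=> mT; apply: (measurability _ (RGenOInfty.measurableE R)) => //.
move=> _ [_ [x ->] <-]; rewrite setTI.
have -> : (fun y => if y \in N then 0 else f y) @^-1` `]x, +oo[ =
   (if x < 0 then N else set0) `|`
   \bigcup_(q in [set q : rat | x <= ratr q]) (B q `\` N).
  apply/seteqP; split => y /=.
    rewrite in_itv/= andbT; case: ifPn => [yN x0|yN xf].
      by left; rewrite x0; exact: set_mem.
    right; have [q] := rat_in_itvoo xf; rewrite in_itv/= => /andP[xq qf].
    exists q; first exact: ltW.
    split; last by move/negP : yN => + yN; apply; exact/mem_set.
    apply: contrapT => nB; move/negP : yN; apply; apply/mem_set; apply: ZN.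
    exists q; first exact: I.
    by have [_ _ _ _] := BZP q; apply; split.
  move=> [|[q /= xq [By nN]]].
    by case: ifP => // x0 Ny; rewrite in_itv/= andbT mem_set.
  rewrite in_itv/= andbT; case: ifPn => [/set_mem//|_].
  by apply: (le_lt_trans xq); have [_ _ _ + _] := BZP q; exact.
apply: measurableU; first by case: ifP.
rewrite bigcup_mkcond; apply: bigcupT_measurable_rat => q; case: ifP => // _.
by apply: measurableD => //; have [] := BZP q.
Qed.

End borel_representative.


(** * Gabor coefficients as Fourier coefficients *)

Section gabor_coefficients.
Context {R : realType}.
Local Notation mu := (@lebesgue_measure R).
Local Notation cmu := (@leb R).
Local Notation borel f := (measurable_fun [set: measurableTypeR R] f).
Implicit Types (f g h : R -> R[i]) (N : set (measurableTypeR R)).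

Definition zero_on N f : R -> R[i] := fun x => if x \in N then 0 else f x.

Definition cborel f := borel (fun x => complex.Re (f x)) /\
  borel (fun x => complex.Im (f x)).

Lemma zero_onE N f x : ~ N x -> zero_on N f x = f x.
Proof. by move=> xN; rewrite /zero_on memNset. Qed.

Lemma cmeasurable_zero_on f : cmeasurable f ->
  exists N, [/\ measurable N, mu N = 0%E &
    forall N', measurable N' -> N `<=` N' -> cborel (zero_on N' f)].
Proof.
move=> [mre mim].
have [N1 [mN1 N10 h1]] := borel_representative mre.
have [N2 [mN2 N20 h2]] := borel_representative mim.
exists (N1 `|` N2); split; [exact: measurableU|by rewrite null_set_setU|].
move=> N mN NN; split.
  have := h1 N mN (subset_trans (@subsetUl _ _ _) NN).
  by congr (measurable_fun _ _); apply/funext => x; rewrite /zero_on; case: ifP.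
have := h2 N mN (subset_trans (@subsetUr _ _ _) NN).
by congr (measurable_fun _ _); apply/funext => x; rewrite /zero_on; case: ifP.
Qed.

Lemma ae_leb N (P : set R) : measurable N -> mu N = 0%E -> (forall x, ~ N x -> P x) ->
  {ae cmu, forall x, P x}.
Proof.
move=> mN N0 NP; exists N; split => //; first exact: measurable_borel_leb.
by move=> x /= nP; apply: contrapT => /NP.
Qed.

(** Completeness of the measure makes [F] measurable, being almost everywhere
    equal to a measurable function. *)
Lemma integral_leb_ae N (F F' : R -> \bar R) : measurable N -> mu N = 0%E ->
  borel F' -> (forall x, ~ N x -> F' x = F x) ->
  (\int[cmu]_x F x = \int[cmu]_x F' x)%E.
Proof.
move=> mN N0 mF' FF'.
have ae1 : ae_eq cmu setT F' F by apply: (ae_leb mN N0) => x /FF'.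
have mF'l : measurable_fun [set: lebR R] (F' : lebR R -> \bar R).
  by apply: (measurableT_comp mF'); exact: measurable_id_leb.
apply: ae_eq_integral => //; last exact: ae_eq_sym.
exact: (ae_measurable_fun completed_lebesgue_measure_is_complete ae1 mF'l).
Qed.

Lemma Rintegral_leb_ae N (F F' : R -> R) : measurable N -> mu N = 0%E ->
  borel F' -> (forall x, ~ N x -> F' x = F x) ->
  \int[cmu]_x F x = \int[mu]_x F' x.
Proof.
move=> mN N0 mF' FF'; rewrite -Rintegral_leb//; congr fine.
apply: (integral_leb_ae mN N0); first exact/measurable_EFinP.
by move=> x /FF' ->.
Qed.

Lemma null_translate N s : measurable N -> mu N = 0%E ->
  measurable ((fun x : R => x + s) @^-1` N : set (measurableTypeR R)) /\
  mu ((fun x : R => x + s) @^-1` N) = 0%E.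
Proof.
move=> mN N0; split; last by rewrite -N0; exact: (lebesgue_measure_translate s mN).
by have := measurable_translation s measurableT mN; rewrite setTI.
Qed.

Lemma L2norm_zero_on N h : in_L2 h -> measurable N -> mu N = 0%E -> cborel (zero_on N h) ->
  let F x := normc (zero_on N h x) ^+ 2 in
  mu.-integrable [set: measurableTypeR R] (EFin \o F) /\
  (L2norm h ^+ 2 = (\int[mu]_x F x)%:E)%E.
Proof.
move=> [_ hfin] mN N0 [mre mim] F.
have mF : borel F.
  rewrite /F; under eq_fun do rewrite sqr_normcE.
  by apply: measurable_funD; exact: measurable_funX.
have F0 x : 0 <= F x by exact: sqr_ge0.
have normE : (L2norm h ^+ 2 = \int[mu]_x (F x)%:E)%E.
  have fin : L2norm h \is a fin_num by rewrite ge0_fin_numE// Lnorm_ge0.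
  have -> : (L2norm h ^+ 2 = L2norm h `^ 2)%E.
    rewrite -(fineK fin) poweR_EFin -EFin_expe; congr EFin.
    by rewrite powR_mulrn// fine_ge0// Lnorm_ge0.
  rewrite /L2norm powR_Lnorm//.
  rewrite -ge0_integral_leb//; last exact/measurable_EFinP.
  apply: (integral_leb_ae mN N0); first exact/measurable_EFinP.
  move=> x Nx; rewrite gee0_abs ?lee_fin ?normc_ge0//.
  by rewrite poweR_EFin powR_mulrn ?normc_ge0// /F zero_onE.
have iF : mu.-integrable [set: measurableTypeR R] (EFin \o F).
  apply/integrableP; split; first exact/measurable_EFinP.
  under eq_integral do rewrite /= ger0_norm//.
  rewrite -normE; have fin : L2norm h \is a fin_num by rewrite ge0_fin_numE// Lnorm_ge0.
  by rewrite -(fineK fin) -EFin_expe ltry.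
split => //; rewrite normE /Rintegral fineK//.
exact: integrable_fin_num.
Qed.

Definition prodRe alpha g h (n : int) x : R :=
  complex.Re (h x * (g (x - alpha * n%:~R))^*%C).
Definition prodIm alpha g h (n : int) x : R :=
  complex.Im (h x * (g (x - alpha * n%:~R))^*%C).

Lemma prodReE alpha g h n x : prodRe alpha g h n x =
  complex.Re (h x) * complex.Re (g (x - alpha * n%:~R)) +
  complex.Im (h x) * complex.Im (g (x - alpha * n%:~R)).
Proof. by rewrite /prodRe; case: (h x) => h1 h2; case: (g _) => g1 g2 /=; ring. Qed.

Lemma prodImE alpha g h n x : prodIm alpha g h n x =
  complex.Im (h x) * complex.Re (g (x - alpha * n%:~R)) -
  complex.Re (h x) * complex.Im (g (x - alpha * n%:~R)).
Proof. by rewrite /prodIm; case: (h x) => h1 h2; case: (g _) => g1 g2 /=; ring. Qed.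

Lemma sqr_prod alpha g h n x : prodRe alpha g h n x ^+ 2 + prodIm alpha g h n x ^+ 2 =
  normc (h x) ^+ 2 * normc (g (x - alpha * n%:~R)) ^+ 2.
Proof. by rewrite -sqr_normcE normcM normc_conj exprMn. Qed.

Lemma borel_prod alpha g h n : cborel g -> cborel h ->
  borel (prodRe alpha g h n) /\ borel (prodIm alpha g h n).
Proof.
move=> [mg1 mg2] [mh1 mh2].
have t1 := borel_translate (- (alpha * n%:~R)) mg1.
have t2 := borel_translate (- (alpha * n%:~R)) mg2.
split.
  have -> : prodRe alpha g h n = (fun x =>
    complex.Re (h x) * complex.Re (g (x - alpha * n%:~R)) +
    complex.Im (h x) * complex.Im (g (x - alpha * n%:~R))).
    by apply/funext => x; rewrite prodReE.
  by apply: measurable_funD; exact: measurable_funM.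
have -> : prodIm alpha g h n = (fun x =>
  complex.Im (h x) * complex.Re (g (x - alpha * n%:~R)) -
  complex.Re (h x) * complex.Im (g (x - alpha * n%:~R))).
  by apply/funext => x; rewrite prodImE.
by apply: measurable_funB; exact: measurable_funM.
Qed.

Lemma sqint_prod alpha g h n (B : R) : cborel g -> cborel h ->
  (forall x, normc (g x) <= B) ->
  mu.-integrable [set: measurableTypeR R] (EFin \o (fun x => normc (h x) ^+ 2)) ->
  sqint mu [set: measurableTypeR R] (prodRe alpha g h n) /\
  sqint mu [set: measurableTypeR R] (prodIm alpha g h n).
Proof.
move=> mg mh gB ih; have [m1 m2] := borel_prod alpha n mg mh.
have i2 := integrableZ_EFin (B ^+ 2) measurableT ih.
have le2 x : prodRe alpha g h n x ^+ 2 + prodIm alpha g h n x ^+ 2 <= B ^+ 2 * normc (h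
  x) ^+ 2.
  rewrite sqr_prod mulrC ler_wpM2r ?sqr_ge0// lerXn2r ?nnegrE ?normc_ge0//.
  exact: le_trans (normc_ge0 _) (gB 0).
split; split => //.
  apply: (@integrable_le _ (measurableTypeR R) R mu setT _ (fun x => B ^+ 2 * normc (h
    x) ^+ 2)) => //.
    exact: measurable_funX.
  move=> x _; rewrite ger0_norm ?sqr_ge0// (le_trans _ (le2 x))//.
  by rewrite lerDl sqr_ge0.
apply: (@integrable_le _ (measurableTypeR R) R mu setT _ (fun x => B ^+ 2 * normc (h x)
  ^+ 2)) => //.
  exact: measurable_funX.
move=> x _; rewrite ger0_norm ?sqr_ge0// (le_trans _ (le2 x))//.
by rewrite lerDr sqr_ge0.
Qed.

Lemma supported_prod alpha beta a b u Q g h n : 0 < beta ->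
  (forall x, x \notin `]a, b[ -> g x = 0) ->
  `|u - alpha * n%:~R| + `|a| + `|b| <= Q%:R * beta^-1 ->
  supported_near u beta Q (prodRe alpha g h n) /\
  supported_near u beta Q (prodIm alpha g h n).
Proof.
move=> b0 g0 uQ; have bi0 : 0 < beta^-1 by rewrite invr_gt0.
suff S x : g (x - alpha * n%:~R) != 0 ->
    u - Q%:R * beta^-1 <= x < u + Q.+1%:R * beta^-1.
  split => x; [rewrite prodReE|rewrite prodImE] => nz; apply: S;
    by apply: contraNneq nz => ->; rewrite !mulr0 ?subrr ?addr0.
move=> gx; have /andP[x1 x2] : a < x - alpha * n%:~R < b.
  apply: contraNT gx => h'; apply/eqP; apply: g0.
  by rewrite in_itv/=.
have := ler_norm (u - alpha * n%:~R); have := ler_norm (- (u - alpha * n%:~R)).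
have := ler_norm b; have := ler_norm (- a).
have := normr_ge0 a; have := normr_ge0 b.
by rewrite !normrN -natr1 mulrDl mul1r => *; apply/andP; split; lra.
Qed.

(** The translated window multiplies [h], the modulation becomes the Fourier
    kernel; replacing [g] and [h] by Borel representatives changes the integrand
    on a null set only. *)
Lemma inner_gabor_atom alpha beta u Q g h (Ng Nh : set (measurableTypeR R)) m n :
  measurable Ng -> mu Ng = 0%E -> cborel (zero_on Ng g) ->
  measurable Nh -> mu Nh = 0%E -> cborel (zero_on Nh h) ->
  let U := prodRe alpha (zero_on Ng g) (zero_on Nh h) n in
  let V := prodIm alpha (zero_on Ng g) (zero_on Nh h) n in
  sqint mu [set: measurableTypeR R] U -> supported_near u beta Q U ->
  sqint mu [set: measurableTypeR R] V -> supported_near u beta Q V ->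
  inner h (gabor_atom g alpha beta m n) = fcoef beta U V m.
Proof.
move=> mNg Ng0 bg mNh Nh0 bh U V sU Uu sV Vu.
have iU := supported_integrable sU Uu; have iV := supported_integrable sV Vu.
have [mT T0] := null_translate (- (alpha * n%:~R)) mNg Ng0.
set T := _ @^-1` Ng in mT T0.
have mN : measurable (Nh `|` T) by exact: measurableU.
have N0 : mu (Nh `|` T) = 0%E by rewrite null_set_setU.
have E x : ~ (Nh `|` T) x -> h x * ((gabor_atom g alpha beta m n) x)^*%C =
    (h x * (g (x - alpha * n%:~R))^*%C) * Complex (cos (phase beta m x)) (- sin (phase
      beta m x)).
  move=> _; rewrite /gabor_atom /expi /phase.
  by rewrite rmorphM/= mulrCA mulrC -!mulrA [X in h x * X]mulrC.
have UE x : ~ (Nh `|` T) x -> U x = complex.Re (h x * (g (x - alpha * n%:~R))^*%C).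
  by move=> /not_orP[n1 n2]; rewrite /U /prodRe !zero_onE.
have VE x : ~ (Nh `|` T) x -> V x = complex.Im (h x * (g (x - alpha * n%:~R))^*%C).
  by move=> /not_orP[n1 n2]; rewrite /V /prodIm !zero_onE.
rewrite /inner /cintegral /fcoef; congr Complex.
  rewrite /cosint /sinint -RintegralD//;
    [|exact: integrable_mul_cos|exact: integrable_mul_sin].
  apply: (Rintegral_leb_ae mN N0).
    apply: measurable_funD; apply: measurable_funM; [exact: sU.1|
      exact: measurable_cos_phase|exact: sV.1|exact: measurable_sin_phase].
  by move=> x Nx; rewrite E// (UE _ Nx) (VE _ Nx); 
  case: (h x * (g (x - alpha * n%:~R))^*%C) => r s /=; ring.
rewrite /cosint /sinint -RintegralB//;
  [|exact: integrable_mul_cos|exact: integrable_mul_sin].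
apply: (Rintegral_leb_ae mN N0).
  apply: measurable_funB; apply: measurable_funM; [exact: sV.1|
    exact: measurable_cos_phase|exact: sU.1|exact: measurable_sin_phase].
by move=> x Nx; rewrite E// (UE _ Nx) (VE _ Nx); 
  case: (h x * (g (x - alpha * n%:~R))^*%C) => r s /=; ring.
Qed.

End gabor_coefficients.


(** * The frame bounds *)

Section frame_bounds.
Context {R : realType}.
Local Notation mu := (@lebesgue_measure R).
Local Notation borel f := (measurable_fun [set: measurableTypeR R] f).
Implicit Types (g h : R -> R[i]) (N : set (measurableTypeR R)).

(** The frame sum, grouped by translation: Parseval's identity applies to each
    inner sum. *)
Definition gabor_sum alpha beta g h : \bar R :=
  (\esum_(n in [set: int]) \esum_(m in [set: int])
    (normc (fcoef beta (prodRe alpha g h n) (prodIm alpha g h n) m) ^+ 2)%:E)%E.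

Lemma Rintegral_scale_le (F G : R -> R) c : 0 <= c ->
  mu.-integrable [set: measurableTypeR R] (EFin \o F) ->
  mu.-integrable [set: measurableTypeR R] (EFin \o G) ->
  (forall x, F x <= c * G x) -> \int[mu]_x F x <= c * \int[mu]_x G x.
Proof.
move=> c0 iF iG FG; rewrite -RintegralZl//.
by apply: le_Rintegral => //; exact: integrableZ_EFin.
Qed.

Lemma floor_cell (alpha x : R) : 0 < alpha ->
  alpha * (Num.floor (x / alpha))%:~R <= x < alpha * (Num.floor (x / alpha))%:~R + alpha.
Proof.
move=> a0; have := floor_le (x / alpha); have := floorD1_gt (x / alpha).
by rewrite ler_pdivlMr// ltr_pdivrMr// intrD mulrDl mul1r mulrC => -> ->.
Qed.

Lemma dist_lattice (alpha L x : R) (j n : int) : 0 < alpha ->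
  alpha * j%:~R <= x < alpha * j%:~R + alpha -> `|x - alpha * n%:~R| <= L ->
  n - j \in symrange (Num.truncn (L / alpha)).+1.
Proof.
move=> a0 /andP[x1 x2]; rewrite ler_norml => /andP[l1 l2].
have L0 : 0 <= L by lra.
rewrite mem_symrange.
have t1 : L / alpha < (Num.truncn (L / alpha)).+1%:R := truncnS_gt _.
rewrite ltr_pdivrMr// in t1.
set t := (Num.truncn _).+1 in t1 *.
rewrite -ltzD1 -(ltr_int R) intrD intr_norm intrB -(ltr_pM2l a0).
rewrite -[X in X * `|_|](gtr0_norm a0) -normrM ltr_norml -!pmulrn mulr1n.
by apply/andP; split; lra.
Qed.

(** The translates of [(a, b)] by [alpha n] that contain [x] have [n] in a range
    of fixed length around [x / alpha]. *)
Lemma overlap_bound (alpha a b : R) : 0 < alpha -> exists D : R, 0 <= D /\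
  forall (r : seq int) (F : int -> R) (M x : R), uniq r -> 0 <= M ->
  (forall n, F n <= M) -> (forall n, ~~ (a < x - alpha * n%:~R < b) -> F n = 0) ->
  \sum_(n <- r) F n <= D * M.
Proof.
move=> a0; pose L : R := `|a| + `|b|; pose t := (Num.truncn (L / alpha)).+1.
exists t.*2.+1%:R; split => // r F M x ur M0 FM F0.
pose j := Num.floor (x / alpha).
have jx := floor_cell x a0.
pose P (n : int) := n - j \in symrange t.
rewrite (bigID P)/= [X in _ + X]big1 ?addr0; last first.
  move=> n nP; apply: F0; apply: contra nP => /andP[x1 x2].
  apply: (dist_lattice a0 jx); rewrite ler_norml /L.
  have := ler_norm b; have := ler_norm (- a); rewrite normrN.
  have := normr_ge0 a; have := normr_ge0 b.
  by move=> *; apply/andP; split; lra.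
rewrite -big_filter (le_trans (ler_sum _ (fun n _ => FM n)))//.
rewrite big_const_seq count_predT iter_addr_0 -[leLHS]mulr_natl.
rewrite ler_wpM2r// ler_nat -size_symrange -(size_map (fun n => n - j)).
apply: uniq_leq_size.
  by rewrite map_inj_uniq ?filter_uniq// => n n' /addIr.
by move=> k /mapP[n]; rewrite mem_filter => /andP[nP _] ->.
Qed.

(** By Bessel's inequality the inner sum for [n] is at most a multiple of the
    integral of [|h|^2] over the [n]-th translate of the support. *)
Lemma gabor_sum_le (a b alpha beta B : R) : 0 < alpha -> 0 < beta -> exists K : R,
  0 <= K /\ forall g h, cborel g -> cborel h -> (forall x, normc (g x) <= B) ->
  (forall x, x \notin `]a, b[ -> g x = 0) ->
  mu.-integrable [set: measurableTypeR R] (EFin \o (fun x => normc (h x) ^+ 2)) ->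
  (gabor_sum alpha beta g h <= (K * \int[mu]_x normc (h x) ^+ 2)%:E)%E.
Proof.
move=> a0 b0; have [D [D0 hD]] := overlap_bound a b a0.
have bi0 : 0 < beta^-1 by rewrite invr_gt0.
pose Q := (Num.truncn ((`|a| + `|b|) * beta)).+1.
have Qb : `|a| + `|b| <= Q%:R * beta^-1.
  by rewrite ler_pdivlMr// ltW// truncnS_gt.
exists (beta^-1 * (Q.*2.+1%:R * (D * B ^+ 2))); split.
  apply: mulr_ge0; first exact: ltW.
  by apply: mulr_ge0 => //; apply: mulr_ge0 => //; exact: sqr_ge0.
move=> g h mg mh gB g0 ih.
have sP n := sqint_prod alpha n mg mh gB ih.
pose u (n : int) := alpha * n%:~R.
have suP n : supported_near (u n) beta Q (prodRe alpha g h n) /\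
    supported_near (u n) beta Q (prodIm alpha g h n).
  by apply: (supported_prod h b0 g0); rewrite /u subrr normr0 add0r.
pose S n x := prodRe alpha g h n x ^+ 2 + prodIm alpha g h n x ^+ 2.
have iS n : mu.-integrable [set: measurableTypeR R] (EFin \o S n).
  by apply: integrableD_EFin => //; [exact: (sP n).1.2|exact: (sP n).2.2].
apply: ge_ereal_sup => _ [X [/finite_set_uniq[r ur ->] _] <-].
rewrite -fsbig_seq//.
apply: (@le_trans _ _ (\sum_(n <- r) (beta^-1 * (Q.*2.+1%:R * \int[mu]_x S n x))%:E)%E).
  apply: lee_sum => n _.
  exact: (esum_fcoef_le b0 (sP n).1 (suP n).1 (sP n).2 (suP n).2).
suff le_int : \sum_(n <- r) \int[mu]_x S n x <=
    D * B ^+ 2 * \int[mu]_x normc (h x) ^+ 2.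
  rewrite sumEFin lee_fin -mulr_sumr -mulr_sumr -mulrA ler_pM2l//.
  by rewrite -[leRHS]mulrA ler_wpM2l.
rewrite -Rintegral_sum//.
apply: Rintegral_scale_le => //.
- by apply: mulr_ge0 => //; exact: sqr_ge0.
- exact: integrable_sum_EFin.
move=> x; rewrite -mulrA; apply: (hD r _ (B ^+ 2 * normc (h x) ^+ 2) x) => //.
  by apply: mulr_ge0; exact: sqr_ge0.
  move=> n; rewrite /S sqr_prod mulrC ler_wpM2r ?sqr_ge0//.
  rewrite lerXn2r ?nnegrE ?normc_ge0//.
  exact: le_trans (normc_ge0 _) (gB 0).
move=> n nx; by rewrite /S sqr_prod g0 ?normc0 ?expr0n ?mulr0// in_itv.
Qed.

Definition cell (alpha : R) (j : int) : set (measurableTypeR R) :=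
  `[alpha * j%:~R, alpha * j%:~R + alpha[%classic.

Lemma measurable_cell alpha j : measurable (cell alpha j).
Proof. exact: measurable_itv. Qed.

Lemma trivIset_cell (alpha : R) (J : set int) : 0 < alpha -> trivIset J (cell alpha).
Proof.
move=> a0 i j _ _ [x [/=]]; rewrite /cell/= !in_itv/= => /andP[i1 i2] /andP[j1 j2].
have h1 : alpha * i%:~R < alpha * (j + 1)%:~R by rewrite intrD; lra.
have h2 : alpha * j%:~R < alpha * (i + 1)%:~R by rewrite intrD; lra.
move: h1 h2; rewrite !ltr_pM2l// !ltr_int !ltzD1 => h1 h2.
by apply/eqP; rewrite eq_le h1 h2.
Qed.

(** Monotone convergence along finite unions of cells, which exhaust the line. *)
Lemma integral_cells_le (alpha : R) (F : R -> \bar R) (C : \bar R) : 0 < alpha ->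
  borel F -> (forall x, 0 <= F x)%E ->
  (forall J, (\sum_(j <- symrange J) \int[mu]_(x in cell alpha j) F x <= C)%E) ->
  (\int[mu]_x F x <= C)%E.
Proof.
move=> a0 mF F0 FC.
pose D (J : nat) : set (measurableTypeR R) := \big[setU/set0]_(j <- symrange J) cell
  alpha j.
have mD J : measurable (D J) by apply: bigsetU_measurable => j _; exact: measurable_cell.
have DP J x : D J x <-> exists2 j, j \in symrange J & cell alpha j x.
  by rewrite /D -bigcup_seq; split => [[j jJ cx]|[j jJ cx]]; exists j.
have ndD : nondecreasing_seq D.
  move=> J J' JJ'; apply/subsetPset => x /DP[j jJ cx]; apply/DP; exists j => //.
  by move: jJ; rewrite !mem_symrange; move: JJ'; clear; lia.
have DT : \bigcup_J D J = setT.
  apply/seteqP; split => // x _; pose j := Num.floor (x / alpha).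
  exists (absz j) => //; apply/DP; exists j; first by rewrite mem_symrange; clear; lia.
  by rewrite /cell/= in_itv/=; exact: floor_cell.
have := @ge0_nondecreasing_set_cvg_integral _ _ _ D F mu ndD mD
  (fun J => measurable_funTS mF) (fun _ x _ => F0 x).
rewrite DT => /cvg_lim <-//; apply: lime_le.
  apply: ereal_nondecreasing_is_cvgn => J J' JJ'.
  apply: ge0_subset_integral => //; [exact: measurable_funTS|].
  exact/subsetPset/ndD.
apply: nearW => J; apply: le_trans (FC J).
rewrite /D ge0_integral_bigsetU//.
- by move=> j; exact: measurable_cell.
- exact: symrange_uniq.
- exact: trivIset_cell.
- exact: measurable_funTS.
Qed.

Lemma esum_shift_ge (T : int -> \bar R) (i : int) J : (forall n, 0 <= T n)%E ->
  (\sum_(j <- symrange J) T (j + i)%R <= \esum_(n in [set: int]) T n)%E.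
Proof.
move=> T0; apply: esum_ge; exists [set` [seq j + i | j <- symrange J]].
  by split => //; exact: finite_seq.
rewrite -fsbig_seq ?big_map//.
by rewrite map_inj_uniq ?symrange_uniq//; exact: addIr.
Qed.

Lemma sume_const (I : Type) (r : seq I) (c : \bar R) : (0 <= c)%E ->
  (\sum_(i <- r) c = (size r)%:R%:E * c)%E.
Proof.
move=> c0; elim: r => [|i r IH]; first by rewrite big_nil mul0e.
by rewrite big_cons IH -[X in (X + _)%E]mul1e -ge0_muleDl ?lee_fin// -EFinD nat1r.
Qed.

(** On the [j]-th cell, [|h|^2] is controlled by the rows [n] near [j], and the
    cell fits in the period window starting at the same point, so its integral is
    at most a multiple of the inner sums for these [n].  Summing over [j] counts
    each [n] boundedly many times. *)
Lemma gabor_sum_ge (a b alpha beta B C L : R) (Q0 : nat) (Z : set (measurableTypeR R)) :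
  0 < alpha -> 0 < beta -> alpha < beta^-1 -> measurable Z -> mu Z = 0%E ->
  exists K : R, 0 < K /\ forall g h, cborel g -> cborel h ->
  (forall x, normc (g x) <= B) -> (forall x, x \notin `]a, b[ -> g x = 0) ->
  (forall Q x, (Q0 <= Q)%N -> ~ Z x -> forall (v : int -> R[i]) t, 0 <= t ->
    (forall n : int, `|x - alpha * n%:~R| <= L ->
       normc (row_sum alpha beta g Q x v n) <= t) ->
    normc (v 0) <= C * t) ->
  mu.-integrable [set: measurableTypeR R] (EFin \o (fun x => normc (h x) ^+ 2)) ->
  ((K * \int[mu]_x normc (h x) ^+ 2)%:E <= gabor_sum alpha beta g h)%E.
Proof.
move=> a0 b0 ab mZ Z0; have bi0 : 0 < beta^-1 by rewrite invr_gt0.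
pose Ln := (Num.truncn (L / alpha)).+1.
pose Q1 := (Num.truncn ((alpha * Ln%:R + `|a| + `|b|) * beta)).+1.
pose Q := maxn Q0 Q1.
have Qb : alpha * Ln%:R + `|a| + `|b| <= Q%:R * beta^-1.
  rewrite (le_trans (y := Q1%:R * beta^-1))//.
    by rewrite ler_pdivlMr// ltW// truncnS_gt.
  by rewrite ler_pM2r// ler_nat leq_maxr.
pose C2 := C ^+ 2 + 1.
have C20 : 0 < C2 by rewrite ltr_wpDl ?sqr_ge0.
pose E := C2 * (beta * Ln.*2.+1%:R).
have E0 : 0 < E by rewrite !mulr_gt0.
exists E^-1; split; first by rewrite invr_gt0.
move=> g h mg mh gB g0 control ih.
have sP n := sqint_prod alpha n mg mh gB ih.
have suP (j i : int) : i \in symrange Ln ->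
    supported_near (alpha * j%:~R) beta Q (prodRe alpha g h (j + i)) /\
    supported_near (alpha * j%:~R) beta Q (prodIm alpha g h (j + i)).
  rewrite mem_symrange => iL; apply: (supported_prod h b0 g0).
  rewrite -mulrBr intrD opprD addrA subrr sub0r normrM normrN gtr0_norm//.
  apply: le_trans Qb; rewrite !lerD2r ler_pM2l// -intr_norm.
  by rewrite -[Ln%:R]/((Ln%:Z)%:~R) ler_int.
pose PU n := periodize beta Q (prodRe alpha g h n).
pose PV n := periodize beta Q (prodIm alpha g h n).
pose T n := (\esum_(m in [set: int])
    (normc (fcoef beta (prodRe alpha g h n) (prodIm alpha g h n) m) ^+ 2)%:E)%E.
have T0 n : (0 <= T n)%E by apply: esum_ge0 => m _; rewrite lee_fin sqr_ge0.
(* The rows of [G(x)] applied to the conjugate samples of [h] are the conjugates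
   of the periodizations at [x]. *)
have rowE n x :
    normc (row_sum alpha beta g Q x (fun k => (h (x + beta^-1 * k%:~R))^*%C) n) ^+ 2
    = PU n x ^+ 2 + PV n x ^+ 2.
  pose w := \sum_(k <- symrange Q) h (x + beta^-1 * k%:~R) *
     (g (x + beta^-1 * k%:~R - alpha * n%:~R))^*%C.
  have -> : row_sum alpha beta g Q x (fun k => (h (x + beta^-1 * k%:~R))^*%C) n = w^*%C.
    rewrite /row_sum /w rmorph_sum; apply: eq_bigr => k _.
    rewrite rmorphM/= conjcK mulrC /ron_shen; congr (_ * g _).
    by rewrite /ron_shen_point; ring.
  rewrite normc_conj sqr_normcE; congr (_ ^+ 2 + _ ^+ 2).
    by rewrite /w /PU /periodize raddf_sum.
  by rewrite /w /PV /periodize raddf_sum.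
pose S (j : int) x := \sum_(i <- symrange Ln) (PU (j + i) x ^+ 2 + PV (j + i) x ^+ 2).
have S0 j x : 0 <= S j x by rewrite sumr_ge0// => i _; rewrite addr_ge0 ?sqr_ge0.
have pointwise (j : int) x : ~ Z x -> cell alpha j x -> normc (h x) ^+ 2 <= C2 * S j x.
  move=> nZ cx.
  have hC : normc (h x) <= C * Num.sqrt (S j x).
    have := control Q x (leq_maxl _ _) nZ (fun k => (h (x + beta^-1 * k%:~R))^*%C)
      (Num.sqrt (S j x)) (sqrtr_ge0 _).
    rewrite normc_conj mulr0z mulr0 addr0; apply => n nL.
    have nj : n - j \in symrange Ln.
      by apply: (dist_lattice a0 _ nL); move: cx; rewrite /cell/= in_itv.
    rewrite -(ler_sqr _ _) ?nnegrE ?normc_ge0 ?sqrtr_ge0// sqr_sqrtr// rowE.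
    have jn : j + (n - j) = n by rewrite addrC subrK.
    rewrite /S (bigD1_seq (n - j)) ?symrange_uniq//= jn lerDl.
    by rewrite sumr_ge0// => i _; rewrite addr_ge0 ?sqr_ge0.
  apply: (@le_trans _ _ ((C * Num.sqrt (S j x)) ^+ 2)).
    rewrite lerXn2r ?nnegrE ?normc_ge0//.
    exact: le_trans (normc_ge0 _) hC.
  by rewrite exprMn sqr_sqrtr// ler_wpM2r// /C2 lerDl.
have mh2 : borel (fun x => normc (h x) ^+ 2).
  by have /integrableP[/measurable_EFinP] := ih.
have mPU n : borel (PU n) by apply: borel_periodize; exact: (sP n).1.1.
have mPV n : borel (PV n) by apply: borel_periodize; exact: (sP n).2.1.
have mS j : borel (S j).
  apply: measurable_sum => i; apply: measurable_funD; exact: measurable_funX.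
have cellT j : (\int[mu]_(x in cell alpha j) (normc (h x) ^+ 2)%:E <=
    (C2 * beta)%:E * \sum_(i <- symrange Ln) T (j + i)%R)%E.
  have mW := measurable_window (alpha * j%:~R) beta.
  apply: (@le_trans _ _ (\int[mu]_(x in cell alpha j) (C2 * S j x)%:E)%E).
    apply: ae_ge0_le_integral => //.
    - exact: measurable_cell.
    - by move=> x _; rewrite lee_fin sqr_ge0.
    - by apply: measurable_funTS; exact/measurable_EFinP.
    - by move=> x _; rewrite lee_fin mulr_ge0// ltW.
    - by apply: measurable_funTS; apply/measurable_EFinP; exact: measurable_funM.
    exists Z; split => // x /= nx; apply: contrapT => nZ; apply: nx => cx.
    by rewrite lee_fin pointwise.
  apply: (@le_trans _ _ (\int[mu]_(x in window (alpha * j%:~R) beta) (C2 * S j x)%:E)%E).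
    apply: ge0_subset_integral => //.
    - exact: measurable_cell.
    - by apply: measurable_funTS; apply/measurable_EFinP; exact: measurable_funM.
    - by move=> x _; rewrite lee_fin mulr_ge0// ltW.
    - move=> x; rewrite /cell /window/= !in_itv/= => /andP[x1 x2].
      by apply/andP; split => //; lra.
  have iP i : i \in symrange Ln ->
      mu.-integrable (window (alpha * j%:~R) beta)
        (EFin \o (fun x => PU (j + i) x ^+ 2)) /\
      mu.-integrable (window (alpha * j%:~R) beta)
        (EFin \o (fun x => PV (j + i) x ^+ 2)).
    move=> iL; split.
      exact: (sqint_periodize _ Q b0 (sP _).1.1 (sP _).1).2.
    exact: (sqint_periodize _ Q b0 (sP _).2.1 (sP _).2).2.
  have iPP i : i \in symrange Ln -> mu.-integrable (window (alpha * j%:~R) beta)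
        (EFin \o (fun x => PU (j + i) x ^+ 2 + PV (j + i) x ^+ 2)).
    by move=> /iP[i1 i2]; exact: integrableD_EFin.
  have iS : mu.-integrable (window (alpha * j%:~R) beta) (EFin \o S j).
    exact: integrable_sum_EFin.
  have -> : (\int[mu]_(x in window (alpha * j%:~R) beta) (C2 * S j x)%:E =
     (\int[mu]_(x in window (alpha * j%:~R) beta) (C2 * S j x))%:E)%E.
    by rewrite /Rintegral fineK//; apply: integrable_fin_num => //; exact: integrableZ_EFin.
  rewrite RintegralZl// [X in C2 * X](Rintegral_sum mW iPP) EFinM -sumEFin EFinM -muleA.
  rewrite lee_pmul2l// ?lte_fin// ge0_sume_distrr//.
  rewrite big_seq [leRHS]big_seq; apply: lee_sum => i iL.
  have [s1 s2] := suP j i iL; have [i1 i2] := iP i iL.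
  rewrite RintegralD//.
  have := esum_fcoef_ge b0 (sP (j + i)).1 s1 (sP (j + i)).2 s2.
  rewrite -/(PU _) -/(PV _) -/(T (j + i)) EFinM => hT.
  rewrite -(@lee_pmul2l _ (beta^-1)%:E)// ?lte_fin//.
  have -> : ((beta^-1)%:E * (beta%:E * T (j + i)%R) = T (j + i)%R)%E.
    by rewrite muleA -EFinM mulVf ?gt_eqF// mul1e.
  exact: hT.
have main : ((\int[mu]_x (normc (h x) ^+ 2)%:E <= E%:E * gabor_sum alpha beta g h)%E).
  apply: (integral_cells_le a0).
  - exact/measurable_EFinP.
  - by move=> x; rewrite lee_fin sqr_ge0.
  move=> J; apply: (@le_trans _ _ (\sum_(j <- symrange J)
      ((C2 * beta)%:E * \sum_(i <- symrange Ln) T (j + i)%R))%E).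
    by apply: lee_sum => j _; exact: cellT.
  rewrite -ge0_sume_distrr; last by move=> j _; exact: sume_ge0.
  have -> : E%:E = ((C2 * beta)%:E * (Ln.*2.+1%:R)%:E)%E by rewrite -EFinM /E mulrA.
  rewrite exchange_big/= -muleA lee_pmul2l// ?lte_fin ?mulr_gt0//.
  apply: (@le_trans _ _ (\sum_(i <- symrange Ln) gabor_sum alpha beta g h)%E).
    by apply: lee_sum => i _; exact: esum_shift_ge.
  have gs0 : (0 <= gabor_sum alpha beta g h)%E by apply: esum_ge0 => n _; exact: T0.
  by rewrite -size_symrange sume_const.
have iE : (\int[mu]_x (normc (h x) ^+ 2)%:E = (\int[mu]_x normc (h x) ^+ 2)%:E)%E.
  by rewrite /Rintegral fineK//; exact: integrable_fin_num.
rewrite iE in main.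
rewrite -(@lee_pmul2l _ E%:E)// ?lte_fin// -EFinM mulrA mulfV ?gt_eqF// mul1r.
exact: main.
Qed.

Lemma generic_null alpha beta N : measurable N -> mu N = 0%E ->
  exists Z : set (measurableTypeR R), [/\ measurable Z, mu Z = 0%E &
    forall x, ~ Z x -> generic alpha beta N x].
Proof.
move=> mN N0.
pose s (nm : int * int) : R := beta^-1 * nm.2%:~R - alpha * nm.1%:~R.
pose P (nm : int * int) : set (measurableTypeR R) := (fun x => x + s nm) @^-1` N.
have PP nm : measurable (P nm) /\ mu (P nm) = 0%E by exact: null_translate.
pose Zn k := if unpickle k is Some nm then P nm else set0.
have mZn k : measurable (Zn k).
  by rewrite /Zn; case: unpickle => [nm|//]; have [] := PP nm.
exists (\bigcup_k Zn k); split.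
- exact: bigcupT_measurable.
- apply/eqP; rewrite eq_le measure_ge0 andbT.
  rewrite (le_trans (measure_sigma_subadditive mu mZn (bigcupT_measurable _ mZn)
    (@subset_refl _ _)))//.
  rewrite eseries0// => k _ _; rewrite /Zn.
  by case: unpickle => [nm|]; [have [] := PP nm|rewrite measure0].
- move=> x nZ n m Nx; apply: nZ; exists (pickle (n, m)); first exact: I.
  rewrite /Zn pickleK /P /s /=; move: Nx; congr N.
  by rewrite /ron_shen_point addrA addrAC.
Qed.

(** On a space of measure zero the essential supremum norm is zero by convention,
    and would bound nothing. *)
Lemma leb_setT_gt0 : (0 < @leb R setT)%E.
Proof.
apply: (@lt_le_trans _ _ (@leb R `[0, 1]%classic)); last exact: le_outer_measure.
have -> : @leb R `[0, 1]%classic = mu `[0, 1]%classic by [].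
by rewrite lebesgue_measure_itv/= lte_fin ltr01 oppr0 adde0 lte_fin ltr01.
Qed.

Lemma in_Linfty_bound (f : R -> R[i]) : in_Linfty f ->
  exists B : R, 0 <= B /\ {ae (@leb R), forall x, normc (f x) <= B}.
Proof.
move=> [_]; rewrite /finite_norm unlock /= leb_setT_gt0.
set e := ess_sup _ _ => eoo.
exists (Num.max 0 (fine e)); split; first by rewrite le_max lexx.
have : (e <= (Num.max 0 (fine e))%:E)%E.
  move: eoo; case: e => [r|//|//] _; last by rewrite leNye.
  by rewrite lee_fin le_max lexx orbT.
move=> /ess_supP; apply: filterS => x.
rewrite -[(abse \o _) x]/(`|(normc (f x))%:E|%E).
by rewrite gee0_abs ?lee_fin ?normc_ge0.
Qed.

Lemma frame_sum_iterated (alpha beta : R) (g h : R -> R[i]) :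
  (\esum_(mn in [set: int * int])
     (normc (inner h (gabor_atom g alpha beta mn.1 mn.2)) ^+ 2)%:E =
  \esum_(n in [set: int]) \esum_(m in [set: int])
     (normc (inner h (gabor_atom g alpha beta m n)) ^+ 2)%:E)%E.
Proof.
pose F (n m : int) := ((normc (inner h (gabor_atom g alpha beta m n)) ^+ 2)%:E : \bar R).
rewrite (@esum_esum _ _ _ _ _ F); last by move=> n m _ _; rewrite lee_fin sqr_ge0.
rewrite (reindex_esum [set: int * int] _ (fun mn => (mn.2, mn.1)))//.
split; first by move=> [m n].
  by move=> [m n] [m' n'] _ _ [-> ->].
by move=> [n m] _; exists (m, n).
Qed.

End frame_bounds.

Theorem theorem2p2 (R : realType) (a b alpha beta : R) (g : R -> R[i])
    (nx mx : R -> int) (lx : R -> nat) (c d delta : R) :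
  a < b -> 0 < alpha -> 0 < beta ->
  alpha * beta < 1 -> irrational (alpha * beta) -> alpha < b - a ->
  in_Linfty g ->
  (forall x : R, x \notin `]a, b[ -> g x = 0) ->
  (let eps := 2^-1 *
     Num.min (b - a - alpha) (Num.min alpha (beta^-1 - alpha)) in
   inv_in_Linfty_on `[a + eps, b - eps] g) ->
  start_choice a b alpha beta nx mx ->
  (forall x : R, x \in `[0, alpha] ->
     biggest_l b alpha beta x (nx x) (mx x) (lx x)) ->
  c < d -> `]c, d[ `<=` `]0, alpha[ ->
  0 < delta ->
  (forall x : R, x \in `]c, d[ ->
     delta <= normc (\det (Mmx g alpha beta x (nx x) (mx x) (lx x)))) ->
  gabor_frame g alpha beta.
Proof.
move=> ab alpha0 beta0 ab1 irr alpha_ba g_infty g_supp.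
set eps := (X in let _ := X in _) => /= -[g_ae g_inv] start big_l cd cdI delta0 detM.
have alpha_beta : alpha < beta^-1 by rewrite -[beta^-1]mul1r ltr_pdivlMr.
have eps0 : 0 < eps.
  by rewrite /eps mulr_gt0// !lt_min alpha0 !subr_gt0 alpha_ba alpha_beta.
have [eps_ba eps_beta] : alpha + 2 * eps <= b - a /\ alpha + 2 * eps <= beta^-1.
  rewrite /eps mulrA mulfV// mul1r; set t := Num.min _ _.
  have t1 : t <= b - a - alpha by rewrite ge_min lexx.
  have t2 : t <= beta^-1 - alpha by rewrite !ge_min lexx !orbT.
  by split; lra.
have [B [B0 gB]] := in_Linfty_bound g_infty.
have [B' [B'0 gB']] := in_Linfty_bound g_inv.
have [Na [mNa Na0 hNa]] := leb_aeP gB.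
have [Nb [mNb Nb0 hNb]] := leb_aeP g_ae.
have [Nc [mNc Nc0 hNc]] := leb_aeP gB'.
have [N2 [mN2 N20 hN2]] := cmeasurable_zero_on g_infty.1.
pose N := Na `|` Nb `|` (Nc `|` N2).
have mN : measurable N by apply: measurableU; exact: measurableU.
have N0 : lebesgue_measure N = 0%E.
  by rewrite !null_set_setU//; exact: measurableU.
have g_bound x : ~ N x -> normc (g x) <= B.
  by move=> nN; apply: hNa => Nx; apply: nN; left; left.
pose eta := (B' + 1)^-1.
have B'1 : 0 < B' + 1 by rewrite ltr_wpDl.
have eta0 : 0 < eta by rewrite invr_gt0.
have g_below x : ~ N x -> x \in `[a + eps, b - eps] -> eta <= normc (g x).
  move=> nN xI.
  have gx0 := hNb x (fun Nx => nN (or_introl (or_intror Nx))).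
  have := hNc x (fun Nx => nN (or_intror (or_introl Nx))).
  have xI' : [set` `[a + eps, b - eps]] x by [].
  rewrite (mem_set xI') normcV => gi.
  have g0 : 0 < normc (g x).
    rewrite lt_neqAle normc_ge0 andbT eq_sym; apply/eqP => /eq0_normc gx.
    by have := gx0 xI'; rewrite gx eqxx.
  rewrite /eta -[leRHS]invrK lef_pV2 ?posrE ?invr_gt0//.
  by rewrite (le_trans gi)// lerDl.
have [C [L [Q0 [C0 control]]]] := rows_control alpha0 beta0 eps0 eta0 B0 irr eps_ba
  eps_beta g_supp g_bound g_below start big_l cd cdI delta0 detM.
have [Z [mZ Z0 Zgen]] := generic_null alpha beta mN N0.
pose g' := zero_on N g.
have mg' : cborel g' by apply: hN2 => // x N2x; right; right.
have g'B x : normc (g' x) <= B.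
  rewrite /g' /zero_on; case: ifPn => [_|/negP xN]; first by rewrite normc0.
  by apply: g_bound => Nx; apply: xN; exact/mem_set.
have g'0 x : x \notin `]a, b[ -> g' x = 0.
  by move=> xI; rewrite /g' /zero_on; case: ifP => // _; exact: g_supp.
have [K1 [K10 upper]] := gabor_sum_le a b B alpha0 beta0.
have [K2 [K20 lower]] := gabor_sum_ge a b B C L Q0 alpha0 beta0 alpha_beta mZ Z0.
exists K2, (K1 + 1); split => //; first by rewrite ltr_wpDl.
move=> h h2 S.
have [Nh [mNh Nh0 hNh]] := cmeasurable_zero_on h2.1.
have mh' := hNh Nh mNh (@subset_refl _ _).
have [ih' normE] := L2norm_zero_on h2 mNh Nh0 mh'.
have SE : S = gabor_sum alpha beta g' (zero_on Nh h).
  rewrite /S frame_sum_iterated; apply: eq_esum => n _; apply: eq_esum => m _.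
  have [sU sV] := sqint_prod alpha n mg' mh' g'B ih'.
  pose Q := (Num.truncn ((`|a| + `|b|) * beta)).+1.
  have Qb : `|alpha * n%:~R - alpha * n%:~R| + `|a| + `|b| <= Q%:R * beta^-1.
    by rewrite subrr normr0 add0r ler_pdivlMr// ltW// truncnS_gt.
  have [Uu Vu] := supported_prod (zero_on Nh h) beta0 g'0 Qb.
  by rewrite (inner_gabor_atom m mN N0 mg' mNh Nh0 mh' sU Uu sV Vu).
rewrite SE normE -!EFinM; split.
  apply: lower => // Q x Q0Q nZ v t t0 rows.
  apply: (control Q x Q0Q (Zgen x nZ) v t t0) => n nL.
  have := rows n nL; congr (normc _ <= _).
  apply: eq_bigr => k _; rewrite /ron_shen /g' zero_onE//; exact: Zgen.
apply: le_trans (upper _ _ mg' mh' g'B g'0 ih') _.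
rewrite lee_fin ler_wpM2r// ?lerDl//.
by apply: Rintegral_ge0 => x _; exact: sqr_ge0.
Qed.
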